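(* Fix $M>0$ and $\theta>1$. Then, uniformly over all $A,B,\Lambda,\Gamma\in\frac12\mathbb Z$ with $A\pm\Lambda\in\mathbb Z$, $B\pm\Gamma\in\mathbb Z$, $A>0$, $B\ge\theta A$, $|\Lambda|\le M\sqrt A$ and $|\Gamma|\le M\sqrt B$, \[ \Pr\bigl[BINGO(A+\Lambda,A-\Lambda;B+\Gamma,B-\Gamma)\bigr] =(1+o_A(1))\sqrt{\frac{2\alpha-1}{\pi}}\,\frac{A^{\alpha-1/2}}{B^\alpha\sqrt{1-(A/B)^{2\alpha-1}}} \exp\Bigl(-\frac{2\alpha-1}{1-(A/B)^{2\alpha-1}}\Bigl(\frac{\Lambda}{A^{1/2}}-\frac{\Gamma}{B^{\alpha}A^{1/2-\alpha}}\Bigr)^2\Bigr), \] where $o_A(1)$ denotes a quantity bounded in absolute value by $\varepsilon(A)$ for some function $\varepsilon$ (depending only on $\alpha,M,\theta$) with $\varepsilon(A)\to0$ as $A\to\infty$. (For $A$ large all coordinates involved are positive integers and the event is well defined.)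
   Context: Fix $\alpha>1$. Consider the Markov chain on $\mathbb N\times\mathbb N$ which from state $(i,j)$ moves to $(i+1,j)$ with probability $i^\alpha/(i^\alpha+j^\alpha)$ and to $(i,j+1)$ with probability $j^\alpha/(i^\alpha+j^\alpha)$. For $a\le c$, $b\le d$, $BINGO(a,b;c,d)$ denotes the event that this chain, started at state $(a,b)$, visits the state $(c,d)$ (and is the empty event if $(c,d)$ is not coordinatewise $\ge(a,b)$). *)

(* Defs.v *)
From Stdlib Require Import Reals Lra Lia ZArith Arith.
Open Scope R_scope.

Definition wt (alpha : R) (i : nat) : R :=
  match i with O => 0 | _ => Rpower (INR i) alpha end.

Definition pright (alpha : R) (i j : nat) : R := wt alpha i / (wt alpha i + wt alpha j).
Definition pup (alpha : R) (i j : nat) : R := wt alpha j / (wt alpha i + wt alpha j).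

(* reach alpha c d n i j = probability that the chain started at (i,j)
   is at state (c,d) after exactly n steps. *)
Fixpoint reach (alpha : R) (c d : nat) (n i j : nat) : R :=
  match n with
  | O => if andb (Nat.eqb i c) (Nat.eqb j d) then 1 else 0
  | S n' => pright alpha i j * reach alpha c d n' (S i) j
            + pup alpha i j * reach alpha c d n' i (S j)
  end.

(* Pr[BINGO(a,b;c,d)]: each step increases i+j by exactly 1, so the chain
   visits (c,d) iff it is at (c,d) at time (c-a)+(d-b). Empty event unless
   (c,d) >= (a,b) coordinatewise. *)
Definition bingo (alpha : R) (a b c d : nat) : R :=
  if andb (Nat.leb a c) (Nat.leb b d) then reach alpha c d ((c - a) + (d - b)) a b
  else 0.

Definition bingo_asymp (alpha A B Lam Gam : R) : R :=
  let q := 1 - Rpower (A / B) (2 * alpha - 1) in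
  sqrt ((2 * alpha - 1) / PI) * Rpower A (alpha - 1/2) / (Rpower B alpha * sqrt q)
  * exp (- ((2 * alpha - 1) / q)
         * (Lam / sqrt A - Gam / (Rpower B alpha * Rpower A (1/2 - alpha))) ^ 2).

(* Main.v *)
(** The walk is embedded in continuous time: coordinate [k] waits an exponential time of rate
    [k^alpha]. Fourier inversion then gives the probability of visiting [(c,d)] from [(i,j)] as
    [(x_c + x_d) / (2 pi)] times the integral over the real line of
    [prod_{k=i..c} 1/(1 - I s x_k) * prod_{k=j..d} 1/(1 + I s x_k)],
    where [x_k = 1/(sg k^alpha)] and the scale [sg] is arbitrary. No probability is needed to see
    this: both sides satisfy the same recurrence, and the boundary terms, whose poles all lie in one
    half-plane, are evaluated by partial fractions. With [sg] the standard deviation of the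
    difference of the two hitting times, the integrand converges to [exp(-s^2/2) cos(mu s)] on
    compact sets and is dominated by [1/(1 + s^2/4)]; the integral is thus
    [sqrt(2 pi) exp(-mu^2/2) + o(1)], which is a relative estimate because [mu] stays bounded. *)

Require Import Defs.
From Stdlib Require Import Reals ZArith Lra Lia List.
From Coquelicot Require Import Coquelicot.
Import ListNotations.
Open Scope R_scope.

(** * Exact Fourier formula *)

(** The polar form keeps the computation over the reals: only the real part is integrated, because
    the imaginary part is odd in [s] and drops out of a symmetric truncation. One small parameter
    controls the limit. The largest [x_k], the two sums of squares and the centring [mu] are all
    known up to [O(A^(-1/2))] once divided by the right power of [sg], which has exact order
    [A^(1/2 - alpha)] because [theta > 1] keeps the variance away from 0. The delicate quantity is
    [mu]: replacing a single sum of [k^(-alpha)] by its integral over [[A,B]] can cost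
    [A^(1/2 - alpha)], as much as [sg] itself. The sums of the two coordinates are therefore
    subtracted before linearising at [A] and [B]; the first-order terms form [mu] and the rest is
    [O(A^(-alpha))]. The error function must also be finite for small [A], uniformly in [B]. There
    the trivial bound of a probability by 1 is too weak, since the asymptotic expression decays like
    [B^(-alpha)]; the Fourier formula with [sg = 1] gives an upper bound of that same order. *)

(* Modulus and argument of [prod_{x in l} 1/(1 - I s x)]. *)
Definition rad (l : list R) (s : R) : R :=
  fold_right (fun x r => r / sqrt (1 + (s * x)²)) 1 l.
Definition ang (l : list R) (s : R) : R :=
  fold_right (fun x r => atan (s * x) + r) 0 l.

(* Real and imaginary part of [prod_{x in xs} 1/(1 - I s x) * prod_{y in ys} 1/(1 + I s y)]. *)
Definition charRe (xs ys : list R) (s : R) : R :=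
  rad xs s * rad ys s * cos (ang xs s - ang ys s).
Definition charIm (xs ys : list R) (s : R) : R :=
  rad xs s * rad ys s * sin (ang xs s - ang ys s).

Lemma one_plus_sqr_pos (t : R) : 0 < 1 + t².
Proof. pose proof (Rle_0_sqr t); lra. Qed.

Lemma sqrt_one_plus_sqr_pos (t : R) : 0 < sqrt (1 + t²).
Proof. apply sqrt_lt_R0, one_plus_sqr_pos. Qed.

(** Removing the factor [1/(1 - I s x)] multiplies the product by [1 - I s x]; this is the real part
    of the result. *)
Lemma charRe_cons_l (x : R) (xs ys : list R) (s : R) :
  charRe xs ys s = charRe (x :: xs) ys s + s * x * charIm (x :: xs) ys s.
Proof.
  unfold charRe, charIm; simpl.
  set (t := s * x); set (r := rad xs s * rad ys s).
  pose proof (sqrt_one_plus_sqr_pos t) as Hq.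
  assert (Hqq : sqrt (1 + t²) * sqrt (1 + t²) = 1 + t²)
    by (apply sqrt_sqrt; pose proof (one_plus_sqr_pos t); lra).
  set (phi := ang xs s - ang ys s).
  replace (atan t + ang xs s - ang ys s) with (atan t + phi) by (unfold phi; ring).
  rewrite cos_plus, sin_plus, cos_atan, sin_atan.
  replace (rad xs s / sqrt (1 + t²) * rad ys s) with (r / sqrt (1 + t²))
    by (unfold r; field; lra).
  set (q := sqrt (1 + t²)) in *.
  transitivity (r * cos phi * ((1 + t²) / (q * q))).
  - rewrite <- Hqq. field. lra.
  - unfold Rsqr. field. lra.
Qed.

Lemma charRe_swap (xs ys : list R) (s : R) : charRe xs ys s = charRe ys xs s.
Proof.
  unfold charRe. rewrite <- cos_neg.
  replace (- (ang xs s - ang ys s)) with (ang ys s - ang xs s) by ring. ring.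
Qed.

Lemma charIm_swap (xs ys : list R) (s : R) : charIm xs ys s = - charIm ys xs s.
Proof.
  unfold charIm.
  replace (ang xs s - ang ys s) with (- (ang ys s - ang xs s)) by ring.
  rewrite sin_neg. ring.
Qed.

Lemma charRe_cons_r (y : R) (xs ys : list R) (s : R) :
  charRe xs ys s = charRe xs (y :: ys) s - s * y * charIm xs (y :: ys) s.
Proof.
  rewrite charRe_swap, (charRe_cons_l y), (charRe_swap (y :: ys)), (charIm_swap (y :: ys)).
  ring.
Qed.

(** From [x + y = y (1 - I s x) + x (1 + I s y)], where each bracket cancels one factor of the
    product. Divided by [x + y], it has the shape of the first-step equation of the chain. *)
Lemma charRe_rec (x y : R) (xs ys : list R) (s : R) :
  (x + y) * charRe (x :: xs) (y :: ys) s
  = y * charRe xs (y :: ys) s + x * charRe (x :: xs) ys s.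
Proof.
  rewrite (charRe_cons_l x xs (y :: ys)), (charRe_cons_r y (x :: xs) ys). ring.
Qed.

(** From [z - y = z (1 + I s y) - y (1 + I s z)]. *)
Lemma charRe_partial_fractions (y z : R) (ys : list R) (s : R) :
  (z - y) * charRe [] (y :: z :: ys) s
  = z * charRe [] (z :: ys) s - y * charRe [] (y :: ys) s.
Proof.
  rewrite (charRe_cons_r y [] (z :: ys)), (charRe_cons_r z [] (y :: ys)).
  assert (Hswap : charRe [] (z :: y :: ys) s = charRe [] (y :: z :: ys) s /\
                  charIm [] (z :: y :: ys) s = charIm [] (y :: z :: ys) s).
  { unfold charRe, charIm; simpl.
    pose proof (sqrt_one_plus_sqr_pos (s * y)). pose proof (sqrt_one_plus_sqr_pos (s * z)).
    replace (atan (s * z) + (atan (s * y) + ang ys s))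
      with (atan (s * y) + (atan (s * z) + ang ys s)) by ring.
    split; field; lra. }
  destruct Hswap as [-> ->]. ring.
Qed.

(** * Truncated integrals and their limits *)

Lemma continuous_rad (l : list R) (s : R) : continuous (rad l) s.
Proof.
  induction l as [|x l IH]; simpl.
  - apply continuous_const.
  - apply (continuous_mult (rad l) (fun s => / sqrt (1 + (s * x)²))); [exact IH|].
    apply (ex_derive_continuous (fun s => / sqrt (1 + (s * x)²))).
    pose proof (one_plus_sqr_pos (s * x)). pose proof (sqrt_one_plus_sqr_pos (s * x)).
    unfold Rsqr in *.
    auto_derive. repeat split; try lra.
Qed.

Lemma continuous_ang (l : list R) (s : R) : continuous (ang l) s.
Proof.
  induction l as [|x l IH]; simpl.
  - apply continuous_const.
  - apply (continuous_plus (fun s => atan (s * x)) (ang l)); [|exact IH].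
    apply (ex_derive_continuous (fun s => atan (s * x))). auto_derive. exact I.
Qed.

Lemma continuous_charRe (xs ys : list R) (s : R) : continuous (charRe xs ys) s.
Proof.
  apply (continuous_mult (fun s => rad xs s * rad ys s) (fun s => cos (ang xs s - ang ys s))).
  - apply (continuous_mult (rad xs) (rad ys)); apply continuous_rad.
  - apply (continuous_comp (fun s => ang xs s - ang ys s) cos).
    + apply (continuous_minus (ang xs) (ang ys)); apply continuous_ang.
    + apply continuous_cos.
Qed.

Lemma ex_RInt_charRe (xs ys : list R) (a b : R) : ex_RInt (charRe xs ys) a b.
Proof. apply (@ex_RInt_continuous R_CompleteNormedModule); intros; apply continuous_charRe. Qed.

(** The integral over the line is always the limit of these at [p_infty]; the linear relations carry
    the existence of the limit along with its value, so no separate integrability proof is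
    required. *)
Definition charInt (xs ys : list R) (T : R) : R := RInt (charRe xs ys) (- T) T.

Lemma charInt_lin (a b : R) (xs ys us vs zs ts : list R) (T : R) :
  (forall s, charRe xs ys s = a * charRe us vs s + b * charRe zs ts s) ->
  charInt xs ys T = a * charInt us vs T + b * charInt zs ts T.
Proof.
  intros H. unfold charInt.
  apply is_RInt_unique.
  apply (is_RInt_ext (fun s => plus (scal a (charRe us vs s)) (scal b (charRe zs ts s)))).
  - intros s _; symmetry; apply H.
  - apply (is_RInt_plus (V := R_NormedModule)); apply (is_RInt_scal (V := R_NormedModule));
      apply (RInt_correct (V := R_CompleteNormedModule)); apply ex_RInt_charRe.
Qed.

Lemma is_lim_charInt_lin (a b l m : R) (xs ys us vs zs ts : list R) :
  (forall s, charRe xs ys s = a * charRe us vs s + b * charRe zs ts s) ->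
  is_lim (charInt us vs) p_infty l -> is_lim (charInt zs ts) p_infty m ->
  is_lim (charInt xs ys) p_infty (a * l + b * m).
Proof.
  intros H Hl Hm.
  apply (is_lim_ext (fun T => a * charInt us vs T + b * charInt zs ts T)).
  - intros T; symmetry; now apply charInt_lin.
  - apply (is_lim_plus' (fun T => a * charInt us vs T) (fun T => b * charInt zs ts T)).
    + exact (is_lim_scal_l _ a p_infty l Hl).
    + exact (is_lim_scal_l _ b p_infty m Hm).
Qed.

Lemma charRe_singleton (y s : R) : charRe [] [y] s = / (1 + (s * y)²).
Proof.
  unfold charRe; simpl.
  replace (0 - (atan (s * y) + 0)) with (- atan (s * y)) by ring.
  rewrite cos_neg, cos_atan.
  pose proof (sqrt_one_plus_sqr_pos (s * y)).
  rewrite <- (sqrt_sqrt (1 + (s * y)²)) at 3 by (pose proof (one_plus_sqr_pos (s * y)); lra).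
  field. lra.
Qed.

Lemma RInt_inv_one_plus_sqr (y T : R) : 0 < y ->
  is_RInt (fun s => / (1 + (s * y)²)) (- T) T (2 * atan (T * y) / y).
Proof.
  intros Hy.
  replace (2 * atan (T * y) / y) with (minus (atan (T * y) / y) (atan (- T * y) / y)).
  2:{ unfold minus, plus, opp; simpl. rewrite Ropp_mult_distr_l_reverse, atan_opp. field. lra. }
  apply (is_RInt_derive (fun s => atan (s * y) / y)).
  - intros s _. pose proof (one_plus_sqr_pos (s * y)). unfold Rsqr in *.
    auto_derive; [exact I|]. unfold Rsqr. field. split; nra.
  - intros s _. apply (ex_derive_continuous (fun s => / (1 + (s * y)²))).
    pose proof (one_plus_sqr_pos (s * y)). unfold Rsqr in *. auto_derive. lra.
Qed.

Lemma is_lim_atan_scal (y : R) : 0 < y -> is_lim (fun T => atan (T * y)) p_infty (PI / 2).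
Proof.
  intros Hy P [eps HP].
  assert (Hpi := PI_RGT_0).
  (* The cap [PI / 4] keeps [PI / 2 - e] in the interval where [atan] inverts [tan]. *)
  set (e := Rmin eps (PI / 4)).
  assert (He : 0 < e) by (apply Rmin_pos; [apply cond_pos|lra]).
  assert (He4 : e <= PI / 4) by apply Rmin_r.
  exists (tan (PI / 2 - e) / y). intros T HT. apply HP.
  assert (Ht : PI / 2 - e < atan (T * y)).
  { rewrite <- (atan_tan (PI / 2 - e)) by lra.
    apply atan_increasing.
    apply (Rmult_lt_compat_r y) in HT; [|lra].
    replace (tan (PI / 2 - e) / y * y) with (tan (PI / 2 - e)) in HT by (field; lra). lra. }
  pose proof (atan_bound (T * y)). pose proof (Rmin_l eps (PI / 4)). fold e in H0.
  change (Rabs (atan (T * y) - PI / 2) < eps).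
  apply Rabs_def1; lra.
Qed.

Lemma is_lim_charInt_singleton (y : R) : 0 < y ->
  is_lim (charInt [] [y]) p_infty (PI / y).
Proof.
  intros Hy.
  apply (is_lim_ext (fun T => (2 / y) * atan (T * y))).
  - intros T. unfold charInt.
    rewrite (RInt_ext _ (fun s => / (1 + (s * y)²)))
      by (intros; apply charRe_singleton).
    symmetry. replace (2 / y * atan (T * y)) with (2 * atan (T * y) / y) by (field; lra).
    apply is_RInt_unique, RInt_inv_one_plus_sqr, Hy.
  - replace (PI / y) with ((2 / y) * (PI / 2)) by (field; lra).
    exact (is_lim_scal_l _ (2 / y) p_infty (PI / 2) (is_lim_atan_scal y Hy)).
Qed.

(** With two or more factors the product decays fast enough to close the contour in the half-plane
    free of poles. Partial fractions replace this argument by removing one factor at a time,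
    distinctness keeping [z - y] invertible; with two factors left, the contributions [PI / (z - y)]
    and [- PI / (z - y)] cancel. *)
Lemma is_lim_charInt_distinct (n : nat) (y z : R) (ys : list R) :
  length ys = n -> NoDup (y :: z :: ys) -> (forall t, In t (y :: z :: ys) -> 0 < t) ->
  is_lim (charInt [] (y :: z :: ys)) p_infty 0.
Proof.
  revert y z ys. induction n as [|n IH]; intros y z ys Hn Hd Hpos.
  all: assert (Hyz : z - y <> 0)
      by (inversion_clear Hd; intro E; apply H; left; lra).
  all: assert (Hrec : forall s, charRe [] (y :: z :: ys) s
      = z / (z - y) * charRe [] (z :: ys) s + - y / (z - y) * charRe [] (y :: ys) s)
      by (intros s; apply (Rmult_eq_reg_l (z - y)); [|exact Hyz];
          rewrite charRe_partial_fractions; field; exact Hyz).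
  - destruct ys; [|discriminate].
    assert (0 < y) by (apply Hpos; simpl; tauto).
    assert (0 < z) by (apply Hpos; simpl; tauto).
    replace (Finite 0) with (Finite (z / (z - y) * (PI / z) + - y / (z - y) * (PI / y)))
      by (f_equal; field; lra).
    apply (is_lim_charInt_lin _ _ _ _ _ _ _ _ _ _ Hrec);
      apply is_lim_charInt_singleton; lra.
  - destruct ys as [|u ys]; [discriminate|].
    replace (Finite 0) with (Finite (z / (z - y) * 0 + - y / (z - y) * 0))
      by (f_equal; field; lra).
    apply (is_lim_charInt_lin _ _ _ _ _ _ _ _ _ _ Hrec); apply IH.
    + now injection Hn.
    + now inversion Hd.
    + intros t Ht; apply Hpos; right; exact Ht.
    + now injection Hn.
    + inversion_clear Hd. inversion_clear H0. constructor; [|assumption].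
      intro Hy; apply H; right; exact Hy.
    + intros t [Ht|Ht]; apply Hpos; [left|right; right]; assumption.
Qed.

Lemma reach_out (alpha : R) (c d n i j : nat) :
  (c < i)%nat \/ (d < j)%nat -> reach alpha c d n i j = 0.
Proof.
  revert i j. induction n as [|n IH]; intros i j H; simpl.
  - destruct (Nat.eqb_spec i c), (Nat.eqb_spec j d); simpl; try reflexivity; lia.
  - rewrite !IH by lia. ring.
Qed.

Section exact_formula.

(** [x k] is the mean waiting time at [k], up to a common factor that the two transition ratios do
    not see. Injectivity serves the partial fractions. *)
Variables (alpha : R) (x : nat -> R) (c d : nat).
Hypothesis x_pos : forall k, (1 <= k)%nat -> 0 < x k.
Hypothesis x_inj : forall k m, (1 <= k)%nat -> (1 <= m)%nat -> x k = x m -> k = m.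
Hypothesis pright_x : forall i j, (1 <= i)%nat -> (1 <= j)%nat ->
  pright alpha i j = x j / (x i + x j).
Hypothesis pup_x : forall i j, (1 <= i)%nat -> (1 <= j)%nat ->
  pup alpha i j = x i / (x i + x j).

Lemma is_lim_charInt_range (i n : nat) : (1 <= i)%nat ->
  is_lim (charInt [] (map x (seq i (S (S n))))) p_infty 0.
Proof using x_pos x_inj.
  intros Hi. apply (is_lim_charInt_distinct n (x i) (x (S i)) (map x (seq (S (S i)) n))).
  - now rewrite length_map, length_seq.
  - change (NoDup (map x (seq i (S (S n))))).
    apply NoDup_map_NoDup_ForallPairs; [|apply seq_NoDup].
    intros k m Hk Hm. apply in_seq in Hk, Hm. apply x_inj; lia.
  - change (forall t, In t (map x (seq i (S (S n)))) -> 0 < t).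
    intros t Ht. apply in_map_iff in Ht. destruct Ht as [k [<- Hk]].
    apply in_seq in Hk. apply x_pos; lia.
Qed.

(** Both sides obey the first-step equation. The lists run over [i..c] and [j..d] inclusive, so at
    [(c,d)] one factor is left on each side, and one more use of the recurrence gives the
    normalisation [2 PI / (x c + x d)]. *)
Lemma is_lim_charInt_reach (n i j : nat) :
  (1 <= i <= c)%nat -> (1 <= j <= d)%nat -> n = ((c - i) + (d - j))%nat ->
  is_lim (charInt (map x (seq i (S c - i))) (map x (seq j (S d - j)))) p_infty
    (2 * PI / (x c + x d) * reach alpha c d n i j).
Proof.
  revert i j. induction n as [|n IH]; intros i j Hi Hj Hn.
  all: assert (Hxi := x_pos i ltac:(lia)); assert (Hxj := x_pos j ltac:(lia));
       assert (Hxc := x_pos c ltac:(lia)); assert (Hxd := x_pos d ltac:(lia)).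
  all: replace (S c - i)%nat with (S (c - i)) by lia;
       replace (S d - j)%nat with (S (d - j)) by lia; cbn [seq map].
  all: assert (Hrec : forall s, charRe (x i :: map x (seq (S i) (c - i)))
                                       (x j :: map x (seq (S j) (d - j))) s
      = x j / (x i + x j) * charRe (map x (seq (S i) (c - i)))
                                   (x j :: map x (seq (S j) (d - j))) s
      + x i / (x i + x j) * charRe (x i :: map x (seq (S i) (c - i)))
                                   (map x (seq (S j) (d - j))) s)
    by (intros s; apply (Rmult_eq_reg_l (x i + x j)); [|lra];
        rewrite charRe_rec; field; lra).
  - replace i with c in * by lia. replace j with d in * by lia.
    rewrite !Nat.sub_diag in *; simpl in *. rewrite !Nat.eqb_refl; simpl.
    replace (Finite (2 * PI / (x c + x d) * 1)) with
      (Finite (x d / (x c + x d) * (PI / x d) + x c / (x c + x d) * (PI / x c)))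
      by (f_equal; field; lra).
    apply (is_lim_charInt_lin _ _ _ _ _ _ _ _ _ _ Hrec).
    + apply is_lim_charInt_singleton; lra.
    + apply (is_lim_ext (charInt [] [x c])).
      * intros T. apply RInt_ext; intros; apply charRe_swap.
      * apply is_lim_charInt_singleton; lra.
  - cbn [reach]. rewrite pright_x, pup_x by lia.
    set (C := 2 * PI / (x c + x d)).
    replace (C * _) with (x j / (x i + x j) * (C * reach alpha c d n (S i) j)
                        + x i / (x i + x j) * (C * reach alpha c d n i (S j))) by ring.
    apply (is_lim_charInt_lin _ _ _ _ _ _ _ _ _ _ Hrec).
    (* On the edge [i = c] a step to the right overshoots and [reach] is 0. The integrand then
       involves [j..d] alone, and [d - j = S n] provides the two or more factors that make its
       integral vanish. *)
    + destruct (Nat.eq_dec i c) as [->|Hic].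
      * rewrite Nat.sub_diag. cbn [seq map].
        rewrite reach_out, Rmult_0_r by lia.
        replace (d - j)%nat with (S n) by lia.
        exact (is_lim_charInt_range j n ltac:(lia)).
      * specialize (IH (S i) j ltac:(lia) ltac:(lia) ltac:(lia)).
        replace (S c - S i)%nat with (c - i)%nat in IH by lia.
        replace (S d - j)%nat with (S (d - j)) in IH by lia. exact IH.
    + destruct (Nat.eq_dec j d) as [->|Hjd].
      * rewrite Nat.sub_diag. cbn [seq map].
        rewrite reach_out, Rmult_0_r by lia.
        replace (c - i)%nat with (S n) by lia.
        apply (is_lim_ext (charInt [] (map x (seq i (S (S n)))))).
        -- intros T. apply RInt_ext; intros; apply charRe_swap.
        -- exact (is_lim_charInt_range i n ltac:(lia)).
      * specialize (IH i (S j) ltac:(lia) ltac:(lia) ltac:(lia)).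
        replace (S d - S j)%nat with (d - j)%nat in IH by lia.
        replace (S c - i)%nat with (S (c - i)) in IH by lia. exact IH.
Qed.

End exact_formula.

(** * Fourier transform of the Gaussian *)

Lemma is_derive_RInt_param_explicit (f df : R -> R -> R) (a b x : R) :
  (forall u t, is_derive (fun u => f u t) u (df u t)) ->
  (forall u t, continuity_2d_pt df u t) ->
  (forall u t, continuous (f u) t) ->
  is_derive (fun u => RInt (f u) a b) x (RInt (df x) a b).
Proof.
  intros Hd Hc Hf.
  rewrite (RInt_ext (df x) (fun t => Derive (fun u => f u t) x)).
  2:{ intros t _. symmetry. apply is_derive_unique, Hd. }
  apply (is_derive_RInt_param f a b x).
  - exists (mkposreal 1 Rlt_0_1). intros u _ t _. eexists; apply Hd.
  - intros t _. apply (continuity_2d_pt_ext df); [|apply Hc].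
    intros u v. symmetry. apply is_derive_unique, Hd.
  - exists (mkposreal 1 Rlt_0_1). intros u _.
    apply (ex_RInt_continuous (V := R_CompleteNormedModule)); intros; apply Hf.
Qed.

Lemma continuity_2d_pt_derivable_comp (f : R -> R) (g : R -> R -> R) (x y : R) :
  derivable f -> continuity_2d_pt g x y -> continuity_2d_pt (fun u v => f (g u v)) x y.
Proof.
  intros Hf Hg. apply continuity_1d_2d_pt_comp; [|exact Hg].
  apply derivable_continuous_pt, Hf.
Qed.

Ltac cont2d :=
  repeat first
    [ apply continuity_2d_pt_mult | apply continuity_2d_pt_plus
    | apply continuity_2d_pt_opp | apply continuity_2d_pt_const
    | apply continuity_2d_pt_id1 | apply continuity_2d_pt_id2
    | apply (continuity_2d_pt_derivable_comp exp); [apply derivable_exp|]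
    | apply (continuity_2d_pt_derivable_comp sin); [apply derivable_sin|]
    | apply (continuity_2d_pt_derivable_comp cos); [apply derivable_cos|] ].

Lemma exp_le_compat (x y : R) : x <= y -> exp x <= exp y.
Proof.
  intros [H| ->]; [left; now apply exp_increasing|apply Rle_refl].
Qed.

Definition gauss (s : R) : R := exp (- (s * s) / 2).

Lemma gauss_le_1 (s : R) : gauss s <= 1.
Proof.
  unfold gauss. rewrite <- exp_0. apply exp_le_compat. nra.
Qed.

Lemma continuous_gauss (s : R) : continuous gauss s.
Proof. apply (ex_derive_continuous gauss). unfold gauss. auto_derive. exact I. Qed.

Definition gaussInt (t : R) : R := RInt gauss 0 t.

Lemma is_derive_gaussInt (t : R) : is_derive gaussInt t (gauss t).
Proof.
  apply (is_derive_RInt gauss gaussInt 0 t); [|apply continuous_gauss].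
  exists (mkposreal 1 Rlt_0_1). intros u _. apply (RInt_correct (V := R_CompleteNormedModule)).
  apply (ex_RInt_continuous (V := R_CompleteNormedModule)); intros; apply continuous_gauss.
Qed.

(* [gaussInt t ^ 2 + 2 * gaussAux t] has derivative 0, and [gaussAux t] decays: this yields the
   Gaussian integral. *)
Definition gaussAux (t : R) : R :=
  RInt (fun x => gauss t * gauss (t * x) * / (1 + x * x)) 0 1.

(** The integrand is [exp (- t^2 (1 + x^2) / 2) / (1 + x^2)]: differentiating in [t] cancels the
    denominator, and the substitution [u = t x] turns the remaining integral into [gaussInt t]. *)
Lemma is_derive_gaussAux (t : R) : is_derive gaussAux t (- (gauss t * gaussInt t)).
Proof.
  assert (Hx : forall x : R, 1 + x * x <> 0) by (intros; nra).
  set (df := fun t x => - t * (gauss t * gauss (t * x))).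
  replace (- (gauss t * gaussInt t)) with (RInt (df t) 0 1).
  - apply (is_derive_RInt_param_explicit
             (fun t x => gauss t * gauss (t * x) * / (1 + x * x)) df).
    + intros u x. unfold df, gauss. auto_derive; [exact I|]. unfold Rdiv. field. apply Hx.
    + intros u x. unfold df, gauss, Rdiv. cont2d.
    + intros u x. apply (ex_derive_continuous (fun x => gauss u * gauss (u * x) * / (1 + x * x))).
      unfold gauss. auto_derive. apply Hx.
  - apply is_RInt_unique.
    replace (- (gauss t * gaussInt t)) with (scal (- gauss t) (RInt gauss (t * 0 + 0) (t * 1 + 0))).
    2:{ unfold scal; simpl; unfold mult; simpl. unfold gaussInt.
        replace (t * 0 + 0) with 0 by ring. replace (t * 1 + 0) with t by ring. ring. }
    apply (is_RInt_ext (fun x => scal (- gauss t) (scal t (gauss (t * x + 0))))).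
    { intros x _. unfold df, scal; simpl; unfold mult; simpl. rewrite Rplus_0_r. ring. }
    apply (is_RInt_scal (V := R_NormedModule)).
    apply (is_RInt_comp_lin gauss t 0 0 1).
    apply (RInt_correct (V := R_CompleteNormedModule)).
    apply (ex_RInt_continuous (V := R_CompleteNormedModule)); intros; apply continuous_gauss.
Qed.

Lemma derive_zero_constant (f : R -> R) (a b : R) :
  (forall x, is_derive f x 0) -> f a = f b.
Proof.
  intros H. destruct (MVT_gen f a b (fun _ => 0)) as [c [_ Hc]].
  - intros; apply H.
  - intros x _. apply continuity_pt_filterlim, (ex_derive_continuous f). eexists; apply H.
  - lra.
Qed.

(** The constant is read off at [t = 0], where [gaussAux] is the integral of [1/(1 + x^2)] over
    [[0,1]], that is [atan 1]. *)
Lemma gaussInt_sqr (t : R) : gaussInt t * gaussInt t + 2 * gaussAux t = PI / 2.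
Proof.
  transitivity (gaussInt 0 * gaussInt 0 + 2 * gaussAux 0).
  - apply (derive_zero_constant (fun t => gaussInt t * gaussInt t + 2 * gaussAux t)).
    intros x.
    assert (H1 := is_derive_gaussInt x). assert (H2 := is_derive_gaussAux x).
    assert (H3 := is_derive_mult gaussInt gaussInt x _ _ H1 H1 Rmult_comm).
    assert (H4 := is_derive_scal gaussAux x 2 _ H2).
    assert (H5 := is_derive_plus _ _ _ _ _ H3 H4).
    replace 0 with (plus (plus (mult (gauss x) (gaussInt x)) (mult (gaussInt x) (gauss x)))
                         (2 * (- (gauss x * gaussInt x)))).
    + exact H5.
    + change (gauss x * gaussInt x + gaussInt x * gauss x + 2 * - (gauss x * gaussInt x) = 0).
      ring.
  - unfold gaussInt. rewrite RInt_point. unfold zero; simpl.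
    assert (E : gaussAux 0 = PI / 4); [|rewrite E; field].
    unfold gaussAux.
    rewrite (RInt_ext _ (fun x => / (1 + x * x))).
    2:{ intros x _. unfold gauss. rewrite !Rmult_0_l, Ropp_0.
        unfold Rdiv. rewrite Rmult_0_l, exp_0, Rmult_1_l. apply Rmult_1_l. }
    apply is_RInt_unique.
    replace (PI / 4) with (minus (atan 1) (atan 0))
      by (rewrite atan_0, atan_1; unfold minus, plus, opp; simpl; ring).
    apply (is_RInt_derive atan).
    + intros x _. auto_derive; [exact I|]. unfold Rsqr. field. nra.
    + intros x _. apply (ex_derive_continuous (fun x => / (1 + x * x))). auto_derive. nra.
Qed.

Lemma gaussAux_bounds (t : R) : 0 <= gaussAux t <= gauss t.
Proof.
  assert (Hex : ex_RInt (fun x => gauss t * gauss (t * x) * / (1 + x * x)) 0 1).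
  { apply (ex_RInt_continuous (V := R_CompleteNormedModule)); intros x _.
    apply (ex_derive_continuous (fun x => gauss t * gauss (t * x) * / (1 + x * x))).
    unfold gauss. auto_derive. nra. }
  assert (Hb : forall x, 0 < gauss t * gauss (t * x) * / (1 + x * x) <= gauss t).
  { intros x. assert (0 < gauss t) by apply exp_pos.
    assert (0 < gauss (t * x)) by apply exp_pos. assert (gauss (t * x) <= 1) by apply gauss_le_1.
    assert (0 < / (1 + x * x)) by (apply Rinv_0_lt_compat; nra).
    assert (/ (1 + x * x) <= 1) by (rewrite <- Rinv_1; apply Rinv_le_contravar; nra).
    split; [repeat apply Rmult_lt_0_compat; assumption|].
    rewrite Rmult_assoc. rewrite <- (Rmult_1_r (gauss t)) at 2.
    apply Rmult_le_compat_l; [lra|]. nra. }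
  split.
  - apply RInt_ge_0; [lra|exact Hex|]. intros x _; apply Rlt_le, Hb.
  - replace (gauss t) with (RInt (fun _ => gauss t) 0 1) at 1
      by (rewrite RInt_const; unfold scal; simpl; unfold mult; simpl; ring).
    apply RInt_le; [lra|exact Hex|apply ex_RInt_const|]. intros x _; apply Hb.
Qed.

(** With [r = sqrt (2 PI) / 2], the product of [r - gaussInt t] and [r + gaussInt t] is
    [2 gaussAux t <= 2 gauss t], and the second factor is at least 1. *)
Lemma gaussInt_half (t : R) : 0 <= t -> Rabs (gaussInt t - sqrt (2 * PI) / 2) <= 2 * gauss t.
Proof.
  intros Ht.
  assert (H := gaussInt_sqr t). assert (Hb := gaussAux_bounds t).
  assert (Hpi : 3 < PI) by (pose proof PI2_3_2; lra).
  set (r := sqrt (2 * PI) / 2).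
  assert (Hr : r * r = PI / 2).
  { unfold r. replace (sqrt (2 * PI) / 2 * (sqrt (2 * PI) / 2))
      with ((sqrt (2 * PI) * sqrt (2 * PI)) / 4) by field.
    rewrite sqrt_sqrt by lra. field. }
  assert (Hr0 : 0 <= r) by (unfold r; pose proof (sqrt_pos (2 * PI)); lra).
  assert (Hr1 : 1 <= r) by nra.
  assert (Hg : 0 <= gaussInt t).
  { apply RInt_ge_0; [lra| |intros; apply Rlt_le, exp_pos].
    apply (ex_RInt_continuous (V := R_CompleteNormedModule)); intros; apply continuous_gauss. }
  assert (Hle : gaussInt t <= r) by nra.
  rewrite Rabs_left1 by lra. nra.
Qed.

Definition gaussFourier (S mu : R) : R := RInt (fun s => gauss s * cos (mu * s)) (- S) S.

(** Integration by parts, with primitive [gauss s * sin (mu s)], gives the linear equation of the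
    Gaussian transform; the truncation at [S] adds the sine term. *)
Lemma is_derive_gaussFourier (S mu : R) :
  is_derive (gaussFourier S) mu (2 * gauss S * sin (mu * S) - mu * gaussFourier S mu).
Proof.
  set (df := fun mu s => - s * gauss s * sin (mu * s)).
  replace (2 * gauss S * sin (mu * S) - mu * gaussFourier S mu) with (RInt (df mu) (- S) S).
  - apply (is_derive_RInt_param_explicit (fun mu s => gauss s * cos (mu * s)) df).
    + intros u s. unfold df, gauss. auto_derive; [exact I|]. ring.
    + intros u s. unfold df, gauss, Rdiv. cont2d.
    + intros u s. apply (ex_derive_continuous (fun s => gauss s * cos (u * s))).
      unfold gauss. auto_derive. exact I.
  - apply is_RInt_unique.
    assert (Hex : is_RInt (fun s => gauss s * cos (mu * s)) (- S) S (gaussFourier S mu)).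
    { apply (RInt_correct (V := R_CompleteNormedModule)).
      apply (ex_RInt_continuous (V := R_CompleteNormedModule)); intros s _.
      apply (ex_derive_continuous (fun s => gauss s * cos (mu * s))).
      unfold gauss. auto_derive. exact I. }
    assert (Hder : is_RInt (fun s => df mu s + mu * (gauss s * cos (mu * s))) (- S) S
               (minus (gauss S * sin (mu * S)) (gauss (- S) * sin (mu * (- S))))).
    { apply (is_RInt_derive (fun s => gauss s * sin (mu * s))).
      - intros s _. unfold df, gauss. auto_derive; [exact I|]. unfold Rdiv; field.
      - intros s _.
        apply (ex_derive_continuous (fun s => df mu s + mu * (gauss s * cos (mu * s)))).
        unfold df, gauss. auto_derive. exact I. }
    assert (Hm := is_RInt_minus _ _ _ _ _ _ Hder (is_RInt_scal _ _ _ mu _ Hex)).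
    replace (2 * gauss S * sin (mu * S) - mu * gaussFourier S mu) with
      (minus (minus (gauss S * sin (mu * S)) (gauss (- S) * sin (mu * - S)))
             (scal mu (gaussFourier S mu))).
    + refine (is_RInt_ext _ _ _ _ _ _ Hm). intros s _.
      unfold minus, plus, opp, scal; simpl; unfold mult; simpl. ring.
    + unfold minus, plus, opp, scal; simpl; unfold mult; simpl.
      replace (mu * - S) with (- (mu * S)) by ring. rewrite sin_neg.
      unfold gauss. replace (- S * - S) with (S * S) by ring. ring.
Qed.

Lemma gaussFourier_0 (S : R) : gaussFourier S 0 = 2 * gaussInt S.
Proof.
  unfold gaussFourier.
  rewrite (RInt_ext _ gauss) by (intros; rewrite Rmult_0_l, cos_0; apply Rmult_1_r).
  assert (Hex : forall a b, ex_RInt gauss a b)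
    by (intros; apply (ex_RInt_continuous (V := R_CompleteNormedModule)); intros; apply continuous_gauss).
  rewrite <- (RInt_Chasles gauss (- S) 0 S) by apply Hex.
  assert (E : RInt gauss (- S) 0 = gaussInt S).
  { rewrite <- (opp_RInt_swap gauss 0 (- S)) by apply Hex. unfold gaussInt.
    symmetry. apply is_RInt_unique.
    assert (H := is_RInt_comp_opp gauss 0 S (RInt gauss (- 0) (- S))
                   (RInt_correct (V := R_CompleteNormedModule) _ _ _ (Hex _ _))).
    rewrite Ropp_0 in H. apply (is_RInt_opp (V := R_NormedModule)) in H.
    refine (is_RInt_ext _ _ _ _ _ _ H). intros s _. rewrite opp_opp.
    unfold gauss. now replace (- s * - s) with (s * s) by ring. }
  rewrite E. unfold plus; simpl. unfold gaussInt. ring.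
Qed.

(** Variation of constants: multiplied by [E m = exp (m^2 / 2)], the transform has only the
    truncation term as derivative, bounded by [2 gauss S * E mu] between 0 and [mu]. The 4 is twice
    the error in [gaussInt S], absorbed by [E mu >= 1]. *)
Lemma gaussFourier_approx (S mu : R) : 0 <= S ->
  Rabs (gaussFourier S mu - sqrt (2 * PI) * exp (- (mu * mu) / 2))
  <= (2 * Rabs mu + 4) * gauss S.
Proof.
  intros HS.
  set (E := fun m => exp (m * m / 2)).
  assert (HE : forall m, is_derive (fun m => E m * gaussFourier S m) m
                           (E m * (2 * gauss S * sin (m * S)))).
  { intros m.
    assert (H1 : is_derive E m (m * E m)) by (unfold E; auto_derive; [exact I|unfold Rdiv; field]).
    assert (H := is_derive_mult _ _ _ _ _ H1 (is_derive_gaussFourier S m) Rmult_comm).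
    replace (E m * (2 * gauss S * sin (m * S))) with
      (plus (mult (m * E m) (gaussFourier S m))
            (mult (E m) (2 * gauss S * sin (m * S) - m * gaussFourier S m)))
      by (unfold plus, mult; simpl; ring).
    exact H. }
  destruct (MVT_gen (fun m => E m * gaussFourier S m) 0 mu
              (fun m => E m * (2 * gauss S * sin (m * S)))) as [c [Hc Heq]].
  - intros; apply HE.
  - intros x _. apply continuity_pt_filterlim.
    apply (ex_derive_continuous (fun m => E m * gaussFourier S m)). eexists; apply HE.
  - assert (HE0 : E 0 = 1) by (unfold E; replace (0 * 0 / 2) with 0 by field; apply exp_0).
    rewrite HE0, gaussFourier_0, Rmult_1_l, Rminus_0_r in Heq.
    assert (HEpos : forall m, 0 < E m) by (intros; apply exp_pos).
    assert (HEinv : exp (- (mu * mu) / 2) = / E mu).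
    { unfold E. replace (- (mu * mu) / 2) with (- (mu * mu / 2)) by field. apply exp_Ropp. }
    assert (Hc2 : c * c <= mu * mu).
    { revert Hc. unfold Rmin, Rmax. destruct (Rle_dec 0 mu); intros; nra. }
    assert (HEc : E c <= E mu) by (apply exp_le_compat; lra).
    assert (HEmu1 : 1 <= E mu).
    { rewrite <- HE0. apply exp_le_compat. nra. }
    assert (Hh := gaussInt_half S HS). set (r := sqrt (2 * PI)) in *.
    rewrite HEinv.
    assert (Hg : 0 < gauss S) by apply exp_pos.
    assert (Hs := SIN_bound (c * S)).
    assert (Hkey : Rabs (E mu * (gaussFourier S mu - r * / E mu))
                   <= E mu * ((2 * Rabs mu + 4) * gauss S)).
    { replace (E mu * (gaussFourier S mu - r * / E mu)) with
        ((E c * (2 * gauss S * sin (c * S)) * mu) + 2 * (gaussInt S - r / 2)).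
      2:{ rewrite <- Heq. field. specialize (HEpos mu); lra. }
      eapply Rle_trans; [apply Rabs_triang|].
      rewrite (Rabs_mult 2), (Rabs_right 2) by lra.
      assert (H1 : Rabs (E c * (2 * gauss S * sin (c * S)) * mu) <= E mu * (2 * gauss S) * Rabs mu).
      { rewrite !Rabs_mult, (Rabs_right (E c)), (Rabs_right 2), (Rabs_right (gauss S))
          by (pose proof (HEpos c); lra).
        apply Rmult_le_compat_r; [apply Rabs_pos|].
        assert (Rabs (sin (c * S)) <= 1) by (apply Rabs_le; lra).
        pose proof (HEpos c). pose proof (Rabs_pos (sin (c * S))).
        apply Rmult_le_compat; try lra; nra. }
      assert (4 * gauss S <= E mu * 4 * gauss S) by nra.
      lra. }
    rewrite Rabs_mult, (Rabs_right (E mu)) in Hkey by (pose proof (HEpos mu); lra).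
    apply (Rmult_le_reg_l (E mu)); [apply HEpos|exact Hkey].
Qed.

(** * Local limit theorem *)

Definition sumR (l : list R) : R := fold_right Rplus 0 l.
Definition sumSq (l : list R) : R := fold_right (fun x r => x * x + r) 0 l.

Lemma sumSq_pos (l : list R) : 0 <= sumSq l.
Proof. induction l; simpl; [lra|nra]. Qed.

Lemma is_lim_Rabs_le (f : R -> R) (J c e T0 : R) :
  is_lim f p_infty J -> (forall T, T0 < T -> Rabs (f T - c) <= e) -> Rabs (J - c) <= e.
Proof.
  intros Hf Hb. apply le_epsilon. intros e' He'.
  assert (HP : Rbar_locally J (fun y => Rabs (y - J) < e')) by (exists (mkposreal e' He'); tauto).
  destruct (Hf _ HP) as [N HN].
  set (T := Rmax T0 N + 1).
  assert (H1 : T0 < T) by (unfold T; pose proof (Rmax_l T0 N); lra).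
  assert (H2 : N < T) by (unfold T; pose proof (Rmax_r T0 N); lra).
  specialize (HN T H2). specialize (Hb T H1). simpl in HN.
  replace (J - c) with ((f T - c) - (f T - J)) by ring.
  eapply Rle_trans; [apply Rabs_triang|]. rewrite Rabs_Ropp. lra.
Qed.

(** * Estimates of modulus and argument *)

Lemma rad_pos (l : list R) (s : R) : 0 < rad l s.
Proof.
  induction l as [|x l IH]; simpl; [lra|].
  apply Rdiv_lt_0_compat; [exact IH|apply sqrt_one_plus_sqr_pos].
Qed.

(** A product of terms [1 + s^2 x^2] is at least 1 plus the sum of the [s^2 x^2]. *)
Lemma rad_sqr_le (l : list R) (s : R) : rad l s * rad l s * (1 + s * s * sumSq l) <= 1.
Proof.
  induction l as [|x l IH]; simpl; [lra|].
  assert (Hq := sqrt_one_plus_sqr_pos (s * x)).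
  assert (Hqq : sqrt (1 + (s * x)²) * sqrt (1 + (s * x)²) = 1 + (s * x)²)
    by (apply sqrt_sqrt; pose proof (one_plus_sqr_pos (s * x)); lra).
  assert (Hp := one_plus_sqr_pos (s * x)).
  set (q := sqrt (1 + (s * x)²)) in *. set (p := 1 + (s * x)²) in *.
  replace (rad l s / q * (rad l s / q)) with (rad l s * rad l s / p)
    by (rewrite <- Hqq; field; lra).
  apply Rle_trans with (rad l s * rad l s / p * (p * (1 + s * s * sumSq l))).
  - apply Rmult_le_compat_l.
    + apply Rmult_le_pos; [pose proof (rad_pos l s); nra|left; now apply Rinv_0_lt_compat].
    + unfold p, Rsqr. pose proof (sumSq_pos l).
      assert (0 <= s * x * (s * x) * (s * s * sumSq l)).
      { apply Rmult_le_pos; [apply Rle_0_sqr|]. apply Rmult_le_pos; [apply Rle_0_sqr|lra]. }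
      lra.
  - replace (rad l s * rad l s / p * (p * (1 + s * s * sumSq l)))
      with (rad l s * rad l s * (1 + s * s * sumSq l)) by (field; lra).
    exact IH.
Qed.

(** Each list alone gives only [(1 + k s^2)^(-1/2)], which is not integrable; the product of the two
    bounds is. *)
Lemma rad_mul_le (k : R) (xs ys : list R) (s : R) :
  0 <= k -> k <= sumSq xs -> k <= sumSq ys -> rad xs s * rad ys s <= / (1 + k * (s * s)).
Proof.
  intros Hk Hx Hy.
  assert (H1 := rad_sqr_le xs s). assert (H2 := rad_sqr_le ys s).
  assert (P1 := rad_pos xs s). assert (P2 := rad_pos ys s).
  assert (Hs : 0 <= s * s) by apply Rle_0_sqr.
  assert (Hu : 1 <= 1 + k * (s * s)) by (pose proof (Rmult_le_pos k _ Hk Hs); lra).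
  assert (K1 : rad xs s * rad xs s * (1 + k * (s * s)) <= 1).
  { eapply Rle_trans; [|exact H1]. apply Rmult_le_compat_l; nra. }
  assert (K2 : rad ys s * rad ys s * (1 + k * (s * s)) <= 1).
  { eapply Rle_trans; [|exact H2]. apply Rmult_le_compat_l; nra. }
  set (u := 1 + k * (s * s)) in *.
  apply (Rmult_le_reg_r u); [lra|]. rewrite Rinv_l by lra.
  set (p := rad xs s) in *. set (q := rad ys s) in *.
  apply Rsqr_incr_0_var; [|lra]. unfold Rsqr.
  replace (p * q * u * (p * q * u)) with ((p * p * u) * (q * q * u)) by ring.
  apply Rmult_le_compat; try lra; apply Rmult_le_pos; nra.
Qed.

Lemma Rabs_charRe_le (xs ys : list R) (s : R) : Rabs (charRe xs ys s) <= rad xs s * rad ys s.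
Proof.
  unfold charRe. pose proof (Rmult_lt_0_compat _ _ (rad_pos xs s) (rad_pos ys s)).
  rewrite Rabs_mult, (Rabs_right (rad xs s * rad ys s)) by lra.
  assert (Rabs (cos (ang xs s - ang ys s)) <= 1) by (apply Rabs_le, COS_bound).
  rewrite <- Rmult_1_r. apply Rmult_le_compat_l; lra.
Qed.

Lemma ln_one_plus_bounds (t : R) : 0 <= t -> t - t * t / 2 <= ln (1 + t) <= t.
Proof.
  intros Ht. split.
  - destruct (MVT_gen (fun u => ln (1 + u) - u + u * u / 2) 0 t (fun u => u * u / (1 + u)))
      as [c [Hc Heq]].
    + intros u Hu. rewrite Rmin_left, Rmax_right in Hu by lra. auto_derive; [lra|]. field. lra.
    + intros u Hu. rewrite Rmin_left, Rmax_right in Hu by lra.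
      apply continuity_pt_filterlim.
      apply (ex_derive_continuous (fun u => ln (1 + u) - u + u * u / 2)). auto_derive. lra.
    + rewrite Rmin_left, Rmax_right in Hc by lra.
      rewrite Rplus_0_r, ln_1 in Heq.
      assert (0 <= c * c / (1 + c) * (t - 0)).
      { apply Rmult_le_pos; [|lra]. apply Rmult_le_pos; [nra|]. left; apply Rinv_0_lt_compat; lra. }
      lra.
  - destruct (Req_dec t 0) as [->|Hn]; [rewrite Rplus_0_r, ln_1; lra|].
    left. rewrite <- (ln_exp t) at 2. apply ln_increasing; [lra|]. apply exp_ineq1; lra.
Qed.

Definition radLog (l : list R) (s : R) : R :=
  fold_right (fun x r => ln (1 + (s * x)²) / 2 + r) 0 l.

Lemma rad_exp (l : list R) (s : R) : rad l s = exp (- radLog l s).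
Proof.
  induction l as [|x l IH]; simpl; [now rewrite Ropp_0, exp_0|].
  rewrite IH, Ropp_plus_distr, exp_plus, (Rmult_comm (exp _)). unfold Rdiv. f_equal.
  rewrite exp_Ropp. f_equal.
  pose proof (one_plus_sqr_pos (s * x)).
  set (q := ln (1 + (s * x)²) * / 2).
  apply sqrt_lem_1; [lra|left; apply exp_pos|].
  rewrite <- exp_plus. unfold q.
  replace (ln (1 + (s * x)²) * / 2 + ln (1 + (s * x)²) * / 2) with (ln (1 + (s * x)²)) by field.
  now apply exp_ln.
Qed.

Lemma radLog_pos (l : list R) (s : R) : 0 <= radLog l s.
Proof.
  induction l as [|x l IH]; simpl; [lra|].
  pose proof (Rle_0_sqr (s * x)).
  assert (0 <= ln (1 + (s * x)²)) by (rewrite <- ln_1; apply ln_le; lra). lra.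
Qed.

(** Each entry contributes an error of at most [s^4 x^4 / 4]. Bounding only one [x^2] by [dl^2]
    leaves the other to be summed, so the length of the list never enters. *)
Lemma radLog_approx (dl : R) (l : list R) (s : R) :
  (forall x, In x l -> 0 < x <= dl) ->
  Rabs (radLog l s - s * s / 2 * sumSq l) <= s * s * (s * s) * (dl * dl) * sumSq l / 4.
Proof.
  intros Hl.
  induction l as [|x l IH]; simpl.
  - replace (0 - s * s / 2 * 0) with 0 by ring. rewrite Rabs_R0. lra.
  - specialize (IH (fun y Hy => Hl y (or_intror Hy))). specialize (Hl x (or_introl eq_refl)).
    assert (Hb := ln_one_plus_bounds (s * x)² (Rle_0_sqr _)).
    unfold Rsqr in *. set (L := ln (1 + s * x * (s * x))) in *.
    replace (L / 2 + radLog l s - s * s / 2 * (x * x + sumSq l))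
      with ((radLog l s - s * s / 2 * sumSq l) + (L - s * x * (s * x)) / 2) by field.
    eapply Rle_trans; [apply Rabs_triang|].
    assert (Hx : Rabs ((L - s * x * (s * x)) / 2) <= s * s * (s * s) * (dl * dl) * (x * x) / 4).
    { assert (H4 : s * x * (s * x) * (s * x * (s * x)) <= s * s * (s * s) * (dl * dl) * (x * x)).
      { replace (s * x * (s * x) * (s * x * (s * x))) with (s * s * (s * s) * (x * x) * (x * x)) by ring.
        apply Rmult_le_compat_r; [nra|]. apply Rmult_le_compat_l; [|nra].
        apply Rmult_le_pos; apply Rle_0_sqr. }
      rewrite Rabs_left1 by lra. lra. }
    lra.
Qed.

Lemma atan_approx (t : R) : Rabs (atan t - t) <= Rabs t * (t * t).
Proof.
  destruct (MVT_gen (fun u => atan u - u) 0 t (fun u => - (u * u / (1 + u * u)))) as [c [Hc Heq]].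
  - intros u _. auto_derive; [exact I|]. unfold Rsqr. field. nra.
  - intros u _. apply continuity_pt_filterlim.
    apply (ex_derive_continuous (fun u => atan u - u)). auto_derive. exact I.
  - assert (Hc2 : c * c <= t * t)
      by (revert Hc; unfold Rmin, Rmax; destruct (Rle_dec 0 t); intros; nra).
    rewrite atan_0, !Rminus_0_r in Heq. rewrite Heq, Rabs_mult, Rabs_Ropp, Rmult_comm.
    apply Rmult_le_compat_l; [apply Rabs_pos|].
    assert (0 <= c * c) by apply Rle_0_sqr.
    assert (0 < / (1 + c * c)) by (apply Rinv_0_lt_compat; lra).
    assert (/ (1 + c * c) <= 1) by (rewrite <- Rinv_1; apply Rinv_le_contravar; lra).
    unfold Rdiv. rewrite Rabs_right by nra. nra.
Qed.

(** The cubic error of [atan] is split as [x^3 <= dl * x^2], again independently of the length of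
    the list. *)
Lemma ang_approx (dl : R) (l : list R) (s : R) :
  (forall x, In x l -> 0 < x <= dl) ->
  Rabs (ang l s - s * sumR l) <= Rabs s * (s * s) * dl * sumSq l.
Proof.
  intros Hl.
  induction l as [|x l IH]; simpl.
  - replace (0 - s * 0) with 0 by ring. rewrite Rabs_R0. lra.
  - specialize (IH (fun y Hy => Hl y (or_intror Hy))). specialize (Hl x (or_introl eq_refl)).
    replace (atan (s * x) + ang l s - s * (x + sumR l))
      with ((ang l s - s * sumR l) + (atan (s * x) - s * x)) by ring.
    eapply Rle_trans; [apply Rabs_triang|].
    assert (Ha := atan_approx (s * x)).
    assert (H3 : Rabs (s * x) * (s * x * (s * x)) <= Rabs s * (s * s) * dl * (x * x)).
    { rewrite Rabs_mult, (Rabs_right x) by lra.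
      replace (Rabs s * x * (s * x * (s * x))) with (Rabs s * (s * s) * x * (x * x)) by ring.
      apply Rmult_le_compat_r; [nra|]. apply Rmult_le_compat_l; [|lra].
      apply Rmult_le_pos; [apply Rabs_pos|apply Rle_0_sqr]. }
    lra.
Qed.

Lemma Rabs_cos_sub_le (a b : R) : Rabs (cos a - cos b) <= Rabs (a - b).
Proof.
  destruct (MVT_gen cos b a (fun u => - sin u)) as [c [_ Heq]].
  - intros u _. auto_derive; [exact I|]. ring.
  - intros u _. apply continuity_cos.
  - rewrite Heq, Rabs_mult, Rabs_Ropp.
    assert (Rabs (sin c) <= 1) by (apply Rabs_le, SIN_bound).
    pose proof (Rabs_pos (a - b)). nra.
Qed.

Lemma Rabs_exp_neg_sub_le (u v : R) : 0 <= u -> 0 <= v ->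
  Rabs (exp (- u) - exp (- v)) <= Rabs (u - v).
Proof.
  intros Hu Hv.
  destruct (MVT_gen (fun t => exp (- t)) v u (fun t => - exp (- t))) as [c [Hc Heq]].
  - intros t _. auto_derive; [exact I|]. ring.
  - intros t _. apply continuity_pt_filterlim.
    apply (ex_derive_continuous (fun t => exp (- t))). auto_derive. exact I.
  - assert (0 <= c) by (pose proof (Rmin_glb v u 0 Hv Hu); lra).
    rewrite Heq, Rabs_mult, Rabs_Ropp, Rabs_right by (left; apply exp_pos).
    assert (exp (- c) <= 1).
    { rewrite <- exp_0. apply exp_le_compat. lra. }
    pose proof (Rabs_pos (u - v)). nra.
Qed.

(** Both [exp (- u)] for [u >= 0] and [cos] are 1-Lipschitz, so errors in the exponent and in the
    angle pass through unchanged: they give the 2 and the 3 in the constant 5. Since [S >= 1], every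
    power of [s] that occurs is at most [S ^ 4]. *)
Lemma charRe_gauss_approx (S dl mu : R) (xs ys : list R) (s : R) :
  1 <= S -> 0 < dl <= 1 / 4 -> Rabs s <= S ->
  (forall x, In x xs -> 0 < x <= dl) -> (forall y, In y ys -> 0 < y <= dl) ->
  Rabs (sumSq xs - 1 / 2) <= dl -> Rabs (sumSq ys - 1 / 2) <= dl ->
  Rabs (sumR xs - sumR ys - mu) <= dl ->
  Rabs (charRe xs ys s - gauss s * cos (mu * s)) <= 5 * S ^ 4 * dl.
Proof.
  intros HS Hdl Hs Hxs Hys Hqx Hqy Hmu.
  assert (Hs0 := Rabs_pos s).
  assert (Hss : s * s = Rabs s * Rabs s) by (rewrite <- Rabs_mult; symmetry; apply Rabs_right, Rle_ge, Rle_0_sqr).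
  assert (Hs2 : s * s <= S * S) by (rewrite Hss; nra).
  assert (Hs20 : 0 <= s * s) by apply Rle_0_sqr.
  apply Rabs_le_between in Hqx. apply Rabs_le_between in Hqy.
  assert (HR : Rabs (rad xs s * rad ys s - gauss s) <= 2 * S ^ 4 * dl).
  { rewrite !rad_exp, <- exp_plus. unfold gauss.
    replace (- radLog xs s + - radLog ys s) with (- (radLog xs s + radLog ys s)) by ring.
    replace (- (s * s) / 2) with (- (s * s / 2)) by field.
    eapply Rle_trans.
    { apply Rabs_exp_neg_sub_le; [|lra].
      pose proof (radLog_pos xs s). pose proof (radLog_pos ys s). lra. }
    assert (H1 := radLog_approx dl xs s Hxs). assert (H2 := radLog_approx dl ys s Hys).
    replace (radLog xs s + radLog ys s - s * s / 2) with
      ((radLog xs s - s * s / 2 * sumSq xs) + (radLog ys s - s * s / 2 * sumSq ys)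
       + s * s / 2 * ((sumSq xs - 1 / 2) + (sumSq ys - 1 / 2))) by field.
    eapply Rle_trans; [apply Rabs_triang|].
    eapply Rle_trans; [apply Rplus_le_compat_r, Rabs_triang|].
    assert (H3 : Rabs (s * s / 2 * ((sumSq xs - 1 / 2) + (sumSq ys - 1 / 2))) <= S * S * dl).
    { rewrite Rabs_mult, (Rabs_right (s * s / 2)) by lra.
      apply Rle_trans with (s * s / 2 * (2 * dl)); [|nra].
      apply Rmult_le_compat_l; [lra|]. apply Rabs_le; lra. }
    assert (H4 : s * s * (s * s) <= S ^ 4).
    { replace (S ^ 4) with (S * S * (S * S)) by ring. nra. }
    assert (H40 : 0 <= s * s * (s * s)) by nra.
    assert (HSS : S * S <= S ^ 4).
    { replace (S ^ 4) with (S * S * (S * S)) by ring. assert (1 <= S * S) by nra. nra. }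
    assert (H5 : forall q, 0 <= q <= 3 / 4 -> s * s * (s * s) * (dl * dl) * q / 4 <= S ^ 4 * dl / 4).
    { intros q Hq. replace (s * s * (s * s) * (dl * dl) * q / 4)
        with (s * s * (s * s) * (dl * (dl * q)) / 4) by field.
      assert (0 <= dl * q <= 1) by nra.
      assert (s * s * (s * s) * (dl * (dl * q)) <= S ^ 4 * dl); [|lra].
      apply Rmult_le_compat; [exact H40|nra|exact H4|nra]. }
    pose proof (H5 (sumSq xs) ltac:(lra)). pose proof (H5 (sumSq ys) ltac:(lra)).
    nra. }
  assert (HC : Rabs (cos (ang xs s - ang ys s) - cos (mu * s)) <= 3 * S ^ 4 * dl).
  { eapply Rle_trans; [apply Rabs_cos_sub_le|].
    assert (H1 := ang_approx dl xs s Hxs). assert (H2 := ang_approx dl ys s Hys).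
    replace (ang xs s - ang ys s - mu * s) with
      ((ang xs s - s * sumR xs) - (ang ys s - s * sumR ys) + s * (sumR xs - sumR ys - mu)) by ring.
    eapply Rle_trans; [apply Rabs_triang|].
    eapply Rle_trans; [apply Rplus_le_compat_r, Rabs_triang|].
    rewrite Rabs_Ropp.
    assert (H3 : Rabs (s * (sumR xs - sumR ys - mu)) <= S * dl).
    { rewrite Rabs_mult. apply Rmult_le_compat; try apply Rabs_pos; assumption. }
    assert (H4 : Rabs s * (s * s) <= S ^ 4).
    { replace (S ^ 4) with ((S * S) * (S * S)) by ring. apply Rmult_le_compat; nra. }
    assert (H40 : 0 <= Rabs s * (s * s)) by nra.
    assert (HSS : S <= S ^ 4).
    { replace (S ^ 4) with (S * (S * (S * S))) by ring.
      assert (1 <= S * S) by nra. assert (1 <= S * (S * S)) by nra. nra. }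
    assert (H5 : forall q, 0 <= q <= 3 / 4 -> Rabs s * (s * s) * dl * q <= S ^ 4 * dl).
    { intros q Hq. rewrite Rmult_assoc. apply Rmult_le_compat; nra. }
    pose proof (H5 (sumSq xs) ltac:(lra)). pose proof (H5 (sumSq ys) ltac:(lra)).
    nra. }
  unfold charRe.
  replace (rad xs s * rad ys s * cos (ang xs s - ang ys s) - gauss s * cos (mu * s)) with
    ((rad xs s * rad ys s - gauss s) * cos (ang xs s - ang ys s)
     + gauss s * (cos (ang xs s - ang ys s) - cos (mu * s))) by ring.
  eapply Rle_trans; [apply Rabs_triang|]. rewrite !Rabs_mult.
  assert (Rabs (cos (ang xs s - ang ys s)) <= 1) by (apply Rabs_le, COS_bound).
  rewrite (Rabs_right (gauss s)) by (left; apply exp_pos).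
  pose proof (gauss_le_1 s). assert (0 < gauss s) by apply exp_pos.
  pose proof (Rabs_pos (rad xs s * rad ys s - gauss s)).
  pose proof (Rabs_pos (cos (ang xs s - ang ys s) - cos (mu * s))).
  pose proof (Rabs_pos (cos (ang xs s - ang ys s))).
  nra.
Qed.

(** The dominating function is relaxed to [4 / s^2], whose primitive is elementary and whose tails
    are uniform in [T]. *)
Lemma RInt_charRe_tail (xs ys : list R) (S T : R) :
  0 < S <= T -> 1 / 4 <= sumSq xs -> 1 / 4 <= sumSq ys ->
  Rabs (RInt (charRe xs ys) S T) <= 4 / S /\ Rabs (RInt (charRe xs ys) (- T) (- S)) <= 4 / S.
Proof.
  intros HS Hx Hy.
  assert (Hb : forall s, s <> 0 -> Rabs (charRe xs ys s) <= 4 / (s * s)).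
  { intros s Hs. eapply Rle_trans; [apply Rabs_charRe_le|].
    eapply Rle_trans; [apply (rad_mul_le (1 / 4)); lra|].
    assert (0 < s * s) by (destruct (Rtotal_order s 0) as [?|[?|?]]; nra).
    replace (4 / (s * s)) with (/ (1 / 4 * (s * s))) by (field; lra).
    apply Rinv_le_contravar; lra. }
  assert (HI : forall a b, a <= b -> (0 < a \/ b < 0) ->
                is_RInt (fun s => 4 / (s * s)) a b (4 / a - 4 / b)).
  { intros a b Hab Hsgn.
    replace (4 / a - 4 / b) with (minus (- 4 / b) (- 4 / a))
      by (unfold minus, plus, opp; simpl; field; lra).
    apply (is_RInt_derive (fun s => - 4 / s)).
    - intros s Hs. rewrite Rmin_left, Rmax_right in Hs by lra.
      assert (s <> 0) by (destruct Hsgn; lra). auto_derive; [assumption|]. field; assumption.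
    - intros s Hs. rewrite Rmin_left, Rmax_right in Hs by lra.
      assert (s <> 0) by (destruct Hsgn; lra).
      apply (ex_derive_continuous (fun s => 4 / (s * s))). auto_derive.
      now apply Rmult_integral_contrapositive_currified. }
  assert (HT : 0 < 4 / T) by (apply Rdiv_lt_0_compat; lra).
  split.
  - apply Rle_trans with (4 / S - 4 / T); [|lra].
    apply (norm_RInt_le (charRe xs ys) (fun s => 4 / (s * s)) S T); [lra| | |].
    + intros s Hs. apply Hb; lra.
    + apply (RInt_correct (V := R_CompleteNormedModule)), ex_RInt_charRe.
    + apply HI; lra.
  - apply Rle_trans with (4 / (- T) - 4 / (- S)).
    2:{ replace (4 / - T - 4 / - S) with (4 / S - 4 / T) by (field; lra). lra. }
    apply (norm_RInt_le (charRe xs ys) (fun s => 4 / (s * s)) (- T) (- S)); [lra| | |].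
    + intros s Hs. apply Hb; lra.
    + apply (RInt_correct (V := R_CompleteNormedModule)), ex_RInt_charRe.
    + apply HI; lra.
Qed.

(** The three summands are the two tails beyond [S], the interval of length [2 S] with pointwise
    error [5 S^4 dl], and the truncation of the Gaussian transform. *)
Lemma charInt_gauss_approx (S T dl mu : R) (xs ys : list R) :
  1 <= S -> S <= T -> 0 < dl <= 1 / 4 ->
  (forall x, In x xs -> 0 < x <= dl) -> (forall y, In y ys -> 0 < y <= dl) ->
  Rabs (sumSq xs - 1 / 2) <= dl -> Rabs (sumSq ys - 1 / 2) <= dl ->
  Rabs (sumR xs - sumR ys - mu) <= dl ->
  Rabs (charInt xs ys T - sqrt (2 * PI) * exp (- (mu * mu) / 2))
  <= 8 / S + 10 * S ^ 5 * dl + (2 * Rabs mu + 4) * gauss S.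
Proof.
  intros HS HT Hdl Hxs Hys Hqx Hqy Hmu.
  assert (Hqx' := Hqx). assert (Hqy' := Hqy).
  apply Rabs_le_between in Hqx'. apply Rabs_le_between in Hqy'.
  destruct (RInt_charRe_tail xs ys S T) as [Ht1 Ht2]; try lra.
  assert (Hex := ex_RInt_charRe xs ys).
  unfold charInt.
  rewrite <- (RInt_Chasles (charRe xs ys) (- T) (- S) T) by apply Hex.
  rewrite <- (RInt_Chasles (charRe xs ys) (- S) S T) by apply Hex.
  unfold plus; simpl.
  assert (Hexg : ex_RInt (fun s => gauss s * cos (mu * s)) (- S) S).
  { apply (ex_RInt_continuous (V := R_CompleteNormedModule)); intros s _.
    apply (ex_derive_continuous (fun s => gauss s * cos (mu * s))).
    unfold gauss. auto_derive. exact I. }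
  assert (Hmid : Rabs (RInt (charRe xs ys) (- S) S - gaussFourier S mu) <= 10 * S ^ 5 * dl).
  { unfold gaussFourier.
    replace (RInt (charRe xs ys) (- S) S - RInt (fun s => gauss s * cos (mu * s)) (- S) S)
      with (RInt (fun s => charRe xs ys s - gauss s * cos (mu * s)) (- S) S).
    2:{ apply is_RInt_unique. apply (is_RInt_minus (V := R_NormedModule));
        apply (RInt_correct (V := R_CompleteNormedModule)); [apply Hex|exact Hexg]. }
    replace (10 * S ^ 5 * dl) with ((S - - S) * (5 * S ^ 4 * dl)) by ring.
    apply abs_RInt_le_const; [lra| |].
    - apply (ex_RInt_minus (V := R_NormedModule)); [apply Hex|exact Hexg].
    - intros s Hs. apply charRe_gauss_approx; try assumption. apply Rabs_le; lra. }
  assert (Hg := gaussFourier_approx S mu ltac:(lra)).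
  set (I1 := RInt (charRe xs ys) (- T) (- S)) in *. set (I2 := RInt (charRe xs ys) (- S) S) in *.
  set (I3 := RInt (charRe xs ys) S T) in *.
  set (G := sqrt (2 * PI) * exp (- (mu * mu) / 2)) in *.
  replace (I1 + (I2 + I3) - G) with
    (I1 + I3 + (I2 - gaussFourier S mu) + (gaussFourier S mu - G)) by ring.
  eapply Rle_trans; [apply Rabs_triang|].
  eapply Rle_trans; [apply Rplus_le_compat_r, Rabs_triang|].
  eapply Rle_trans; [apply Rplus_le_compat_r, Rplus_le_compat_r, Rabs_triang|].
  replace (8 / S) with (4 / S + 4 / S) by (field; lra).
  lra.
Qed.

(** The cut-off [S] depends on [K] and [eps] alone, and [dl0] on [S] and [eps]; one [dl0] therefore
    serves all lists and all [mu] at once, which is the source of uniformity in the final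
    statement. *)
Lemma local_limit (K eps : R) : 0 < K -> 0 < eps ->
  exists dl0, 0 < dl0 /\ forall dl xs ys mu J,
    0 < dl <= dl0 -> Rabs mu <= K ->
    (forall x, In x xs -> 0 < x <= dl) -> (forall y, In y ys -> 0 < y <= dl) ->
    Rabs (sumSq xs - 1 / 2) <= dl -> Rabs (sumSq ys - 1 / 2) <= dl ->
    Rabs (sumR xs - sumR ys - mu) <= dl ->
    is_lim (charInt xs ys) p_infty (Finite J) ->
    Rabs (J - sqrt (2 * PI) * exp (- (mu * mu) / 2)) <= eps.
Proof.
  intros HK Heps.
  (* The 24 gives [8 / S <= eps / 3]; the other term gives [(2 K + 4) * (2 / S) <= eps / 3], to be
     combined with [gauss S <= 2 / S]. *)
  set (S := 1 + (24 + 6 * (2 * K + 4)) / eps).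
  assert (HS1 : 0 < (24 + 6 * (2 * K + 4)) / eps) by (apply Rdiv_lt_0_compat; lra).
  assert (HS : 1 <= S) by (unfold S; lra).
  assert (HSe : 24 + 6 * (2 * K + 4) <= S * eps).
  { unfold S. rewrite Rmult_plus_distr_r. unfold Rdiv at 1.
    rewrite Rmult_assoc, Rinv_l by lra. lra. }
  assert (HS5 : 0 < S ^ 5) by (apply pow_lt; lra).
  exists (Rmin (1 / 4) (eps / (30 * S ^ 5))).
  assert (Hq : 0 < eps / (30 * S ^ 5)) by (apply Rdiv_lt_0_compat; lra).
  split; [apply Rmin_pos; lra|].
  intros dl xs ys mu J Hdl Hmu Hxs Hys Hqx Hqy Hm HJ.
  assert (Hd1 := Rmin_l (1 / 4) (eps / (30 * S ^ 5))).
  assert (Hd2 := Rmin_r (1 / 4) (eps / (30 * S ^ 5))).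
  apply (is_lim_Rabs_le (charInt xs ys) J _ eps S HJ).
  intros T HT.
  eapply Rle_trans; [apply (charInt_gauss_approx S T dl mu xs ys); try assumption; lra|].
  assert (H1 : 8 / S <= eps / 3).
  { apply (Rmult_le_reg_r S); [lra|]. replace (8 / S * S) with 8 by (field; lra). nra. }
  assert (H2 : 10 * S ^ 5 * dl <= eps / 3).
  { apply Rle_trans with (10 * S ^ 5 * (eps / (30 * S ^ 5))).
    - apply Rmult_le_compat_l; lra.
    - right; field; lra. }
  assert (H3 : gauss S <= 2 / S).
  { unfold gauss. replace (- (S * S) / 2) with (- (S * S / 2)) by field. rewrite exp_Ropp.
    replace (2 / S) with (/ (S / 2)) by (field; lra).
    apply Rinv_le_contravar; [lra|].
    pose proof (exp_ineq1_le (S * S / 2)). nra. }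
  assert (H4 : (2 * Rabs mu + 4) * gauss S <= eps / 3).
  { apply Rle_trans with ((2 * K + 4) * (2 / S)).
    - apply Rmult_le_compat; try lra; [pose proof (Rabs_pos mu); lra|left; apply exp_pos].
    - apply (Rmult_le_reg_r S); [lra|].
      replace ((2 * K + 4) * (2 / S) * S) with ((2 * K + 4) * 2) by (field; lra). nra. }
  lra.
Qed.

(** * Sums of powers *)

Lemma Rpower_pos (x p : R) : 0 < Rpower x p.
Proof. apply exp_pos. Qed.

Lemma Rpower_neg_le (x y p : R) : 0 < x <= y -> 0 <= p -> Rpower y (- p) <= Rpower x (- p).
Proof.
  intros Hxy Hp. rewrite !Rpower_Ropp.
  apply Rinv_le_contravar; [apply Rpower_pos|]. apply Rle_Rpower_l; lra.
Qed.

Lemma Rpower_half_neg (x p : R) : 0 < x -> Rpower (x / 2) (- p) = Rpower 2 p * Rpower x (- p).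
Proof.
  intros Hx. unfold Rpower. rewrite <- exp_plus. f_equal.
  rewrite ln_div by lra. ring.
Qed.

Lemma is_derive_Rpower (p x : R) : 0 < x ->
  is_derive (fun u => Rpower u p) x (p * Rpower x (p - 1)).
Proof.
  intros Hx. unfold Rpower at 1. auto_derive; [exact Hx|].
  replace (Rpower x (p - 1)) with (exp (p * ln x) * / x); [ring|].
  rewrite <- (exp_ln x Hx) at 2. rewrite <- exp_Ropp, <- exp_plus.
  unfold Rpower. f_equal. ring.
Qed.

Lemma MVT_bound (f df : R -> R) (m C x y : R) :
  0 < m -> m <= x -> m <= y ->
  (forall u, 0 < u -> is_derive f u (df u)) ->
  (forall u, Rmin x y <= u <= Rmax x y -> Rabs (df u) <= C) ->
  Rabs (f y - f x) <= C * Rabs (y - x).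
Proof.
  intros Hm Hx Hy Hd Hb.
  assert (Hpos : forall u, Rmin x y <= u -> 0 < u)
    by (intros u Hu; pose proof (Rmin_glb x y m Hx Hy); lra).
  destruct (MVT_gen f x y df) as [c [Hc ->]].
  - intros u Hu. apply Hd, Hpos; lra.
  - intros u Hu. apply continuity_pt_filterlim, (ex_derive_continuous f).
    eexists. apply Hd, Hpos; lra.
  - rewrite Rabs_mult. apply Rmult_le_compat_r; [apply Rabs_pos|]. now apply Hb.
Qed.

Lemma Rpower_neg_lip (p m x y : R) : 0 < p -> 0 < m -> m <= x -> m <= y ->
  Rabs (Rpower y (- p) - Rpower x (- p)) <= p * Rpower m (- (p + 1)) * Rabs (y - x).
Proof.
  intros Hp Hm Hx Hy.
  apply (MVT_bound (fun u => Rpower u (- p)) (fun u => - p * Rpower u (- p - 1)) m);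
    try assumption.
  - intros u Hu. now apply is_derive_Rpower.
  - intros u Hu. pose proof (Rmin_glb x y m Hx Hy).
    rewrite Rabs_mult, Rabs_Ropp, (Rabs_right p) by lra.
    rewrite (Rabs_right (Rpower u _)) by (left; apply Rpower_pos).
    apply Rmult_le_compat_l; [lra|].
    replace (- p - 1) with (- (p + 1)) by ring. apply Rpower_neg_le; lra.
Qed.

Definition powPrim (p x : R) : R := Rpower x (1 - p) / (1 - p).

Lemma is_derive_powPrim (p x : R) : 1 < p -> 0 < x -> is_derive (powPrim p) x (Rpower x (- p)).
Proof.
  intros Hp Hx.
  assert (H := is_derive_scal (fun u => Rpower u (1 - p)) x (/ (1 - p)) _
                 (is_derive_Rpower (1 - p) x Hx)).
  replace (/ (1 - p) * ((1 - p) * Rpower x (1 - p - 1))) with (Rpower x (- p)) in H.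
  - refine (is_derive_ext _ _ _ _ _ H). intros t. unfold powPrim, Rdiv. apply Rmult_comm.
  - replace (1 - p - 1) with (- p) by ring. field. lra.
Qed.

Lemma powPrim_lip (p m x y : R) : 1 < p -> 0 < m -> m <= x -> m <= y ->
  Rabs (powPrim p y - powPrim p x) <= Rpower m (- p) * Rabs (y - x).
Proof.
  intros Hp Hm Hx Hy.
  apply (MVT_bound (powPrim p) (fun u => Rpower u (- p)) m); try assumption.
  - intros; now apply is_derive_powPrim.
  - intros u Hu. pose proof (Rmin_glb x y m Hx Hy).
    rewrite Rabs_right by (left; apply Rpower_pos). apply Rpower_neg_le; lra.
Qed.

(** Once the tangent direction [u * x^(-p)] is subtracted, the derivative is [u^(-p) - x^(-p)], of
    order [t] near [x]; over an interval of length [2 |t|] this leaves an error quadratic in [t]. *)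
Lemma powPrim_symmetric_diff (p m x t : R) : 1 < p -> 0 < m -> m <= x - Rabs t ->
  Rabs (powPrim p (x + t) - powPrim p (x - t) - 2 * t * Rpower x (- p))
  <= 2 * p * Rpower m (- (p + 1)) * (t * t).
Proof.
  intros Hp Hm Hx.
  assert (Ht : - Rabs t <= t <= Rabs t) by (split; [pose proof (Rle_abs (- t)) as H; rewrite Rabs_Ropp in H; lra|apply Rle_abs]).
  pose proof (Rabs_pos t).
  assert (Htt : t * t = Rabs t * Rabs t)
    by (rewrite <- Rabs_mult; symmetry; apply Rabs_right, Rle_ge, Rle_0_sqr).
  replace (powPrim p (x + t) - powPrim p (x - t) - 2 * t * Rpower x (- p)) with
    ((powPrim p (x + t) - (x + t) * Rpower x (- p)) - (powPrim p (x - t) - (x - t) * Rpower x (- p)))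
    by ring.
  replace (2 * p * Rpower m (- (p + 1)) * (t * t)) with
    (p * Rpower m (- (p + 1)) * Rabs t * Rabs (x + t - (x - t))).
  2:{ replace (x + t - (x - t)) with (2 * t) by ring.
      rewrite Rabs_mult, (Rabs_right 2), Htt by lra. ring. }
  apply (MVT_bound (fun u => powPrim p u - u * Rpower x (- p))
           (fun u => Rpower u (- p) - Rpower x (- p)) m); try lra.
  - intros u Hu. apply (is_derive_minus (powPrim p) (fun u => u * Rpower x (- p))).
    + now apply is_derive_powPrim.
    + auto_derive; [exact I|ring].
  - intros u Hu.
    assert (Hu2 : x - Rabs t <= u <= x + Rabs t).
    { pose proof (Rmin_glb (x - t) (x + t) (x - Rabs t)).
      pose proof (Rmax_lub (x - t) (x + t) (x + Rabs t)). lra. }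
    eapply Rle_trans; [apply (Rpower_neg_lip p m); lra|].
    apply Rmult_le_compat_l.
    + apply Rmult_le_pos; [lra|left; apply Rpower_pos].
    + apply Rabs_le; lra.
Qed.

Definition powList (p : R) (i n : nat) : list R :=
  map (fun k => Rpower (INR k) (- p)) (seq i n).

(** Integral comparison for a decreasing summand: each unit integral lies between consecutive terms,
    and the resulting bounds telescope to the first term. The sum includes both endpoints, hence
    length [S n] against an interval of length [n]. *)
Lemma sumR_powList (p : R) (i n : nat) : 1 < p -> (1 <= i)%nat ->
  0 <= sumR (powList p i (S n)) - (powPrim p (INR (i + n)) - powPrim p (INR i))
    <= Rpower (INR i) (- p).
Proof.
  intros Hp. revert i. induction n as [|n IH]; intros i Hi.
  - unfold powList; simpl. rewrite Nat.add_0_r. pose proof (Rpower_pos (INR i) (- p)). lra.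
  - specialize (IH (S i) ltac:(lia)).
    replace (S i + n)%nat with (i + S n)%nat in IH by lia.
    change (sumR (powList p i (S (S n))))
      with (Rpower (INR i) (- p) + sumR (powList p (S i) (S n))).
    set (Sm := sumR (powList p (S i) (S n))) in *.
    assert (Hi1 : 1 <= INR i) by (apply (le_INR 1), Hi).
    assert (HSi : INR (S i) = INR i + 1) by apply S_INR.
    assert (Hstep : Rpower (INR (S i)) (- p) <= powPrim p (INR (S i)) - powPrim p (INR i)
                    <= Rpower (INR i) (- p)).
    { destruct (MVT_gen (powPrim p) (INR i) (INR (S i)) (fun u => Rpower u (- p))) as [z [Hz Heq]].
      - intros u Hu. rewrite Rmin_left in Hu by lra. apply is_derive_powPrim; lra.
      - intros u Hu. rewrite Rmin_left in Hu by lra.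
        apply continuity_pt_filterlim, (ex_derive_continuous (powPrim p)).
        eexists. apply is_derive_powPrim; lra.
      - rewrite Rmin_left, Rmax_right in Hz by lra.
        rewrite Heq, HSi. replace (INR i + 1 - INR i) with 1 by ring. rewrite Rmult_1_r.
        split; apply Rpower_neg_le; lra. }
    lra.
Qed.

Lemma Rpower_neg_sqrt (x p : R) : 0 < x -> Rpower x (- p) * sqrt x = Rpower x (1 / 2 - p).
Proof.
  intros Hx. rewrite <- (Rpower_sqrt x) by exact Hx.
  rewrite <- Rpower_plus. f_equal. lra.
Qed.

(** Moving the two endpoints by [M sqrt A] and [M sqrt B] gives the [2 M], the first term of the sum
    gives the 1, and [2^p] comes from working above [A / 2]. With [p = 2 alpha] the error is
    [A^(-1/2)] relative to the variance. *)
Lemma sumR_powList_approx (p M A B L G : R) (i c : nat) :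
  1 < p -> 0 < M -> 1 <= A <= B ->
  Rabs L <= M * sqrt A -> Rabs G <= M * sqrt B -> M * sqrt A <= A / 2 -> M * sqrt B <= B / 2 ->
  INR i = A + L -> INR c = B + G -> (1 <= i <= c)%nat ->
  Rabs (sumR (powList p i (S c - i)) - (powPrim p B - powPrim p A))
  <= (2 * M + 1) * Rpower 2 p * Rpower A (1 / 2 - p).
Proof.
  intros Hp HM HAB HL HG HA2 HB2 Hi Hc Hic.
  assert (HS := sumR_powList p i (c - i) Hp ltac:(lia)).
  replace (S (c - i)) with (S c - i)%nat in HS by lia.
  replace (i + (c - i))%nat with c in HS by lia.
  assert (HL2 := proj1 (Rabs_le_between L (A / 2)) ltac:(lra)).
  assert (HG2 := proj1 (Rabs_le_between G (B / 2)) ltac:(lra)).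
  assert (H1 := powPrim_lip p (A / 2) A (A + L) Hp ltac:(lra) ltac:(lra) ltac:(lra)).
  assert (H2 := powPrim_lip p (B / 2) B (B + G) Hp ltac:(lra) ltac:(lra) ltac:(lra)).
  rewrite <- Hi in H1. rewrite <- Hc in H2.
  replace (INR i - A) with L in H1 by lra. replace (INR c - B) with G in H2 by lra.
  rewrite Rpower_half_neg in H1, H2 by lra.
  assert (P2 := Rpower_pos 2 p).
  assert (HsA : 1 <= sqrt A) by (rewrite <- sqrt_1; apply sqrt_le_1; lra).
  assert (PA := Rpower_pos A (- p)). assert (PB := Rpower_pos B (- p)).
  assert (HhA := Rpower_neg_sqrt A p ltac:(lra)). assert (HhB := Rpower_neg_sqrt B p ltac:(lra)).
  set (hA := Rpower A (1 / 2 - p)) in *. set (hB := Rpower B (1 / 2 - p)) in *.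
  assert (HhAB : hB <= hA).
  { unfold hA, hB. replace (1 / 2 - p) with (- (p - 1 / 2)) by ring. apply Rpower_neg_le; lra. }
  assert (K1 : Rpower 2 p * Rpower A (- p) * Rabs L <= M * Rpower 2 p * hA).
  { rewrite <- HhA. apply Rle_trans with (Rpower 2 p * Rpower A (- p) * (M * sqrt A)).
    - apply Rmult_le_compat_l; [nra|exact HL].
    - right; ring. }
  assert (K2 : Rpower 2 p * Rpower B (- p) * Rabs G <= M * Rpower 2 p * hA).
  { apply Rle_trans with (M * Rpower 2 p * hB); [|apply Rmult_le_compat_l; nra].
    rewrite <- HhB. apply Rle_trans with (Rpower 2 p * Rpower B (- p) * (M * sqrt B)).
    - apply Rmult_le_compat_l; [nra|exact HG].
    - right; ring. }
  assert (K3 : Rpower (INR i) (- p) <= Rpower 2 p * hA).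
  { apply Rle_trans with (Rpower (A / 2) (- p)); [apply Rpower_neg_le; lra|].
    rewrite Rpower_half_neg by lra. apply Rmult_le_compat_l; [lra|]. rewrite <- HhA. nra. }
  replace ((2 * M + 1) * Rpower 2 p * hA)
    with (M * Rpower 2 p * hA + M * Rpower 2 p * hA + Rpower 2 p * hA) by ring.
  apply Rabs_le_between in H1. apply Rabs_le_between in H2.
  apply Rabs_le. lra.
Qed.

Lemma powPrim_symmetric_diff_sqrt (p M x t : R) :
  1 < p -> 0 < M -> 0 < x -> Rabs t <= M * sqrt x -> M * sqrt x <= x / 2 ->
  Rabs (powPrim p (x + t) - powPrim p (x - t) - 2 * t * Rpower x (- p))
  <= 4 * p * Rpower 2 p * (M * M) * Rpower x (- p).
Proof.
  intros Hp HM Hx Ht Hx2.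
  eapply Rle_trans; [apply (powPrim_symmetric_diff p (x / 2)); lra|].
  rewrite Rpower_half_neg by lra.
  assert (E1 : Rpower 2 (p + 1) = Rpower 2 p * 2) by (rewrite Rpower_plus, Rpower_1; lra).
  assert (E2 : Rpower x (- (p + 1)) * x = Rpower x (- p)).
  { rewrite <- (Rpower_1 x Hx) at 2. rewrite <- Rpower_plus. f_equal. ring. }
  assert (Htt : t * t <= M * M * x).
  { replace (M * M * x) with (M * sqrt x * (M * sqrt x)).
    - replace (t * t) with (Rabs t * Rabs t)
        by (rewrite <- Rabs_mult; apply Rabs_right, Rle_ge, Rle_0_sqr).
      apply Rmult_le_compat; try apply Rabs_pos; assumption.
    - rewrite <- (sqrt_sqrt x) at 3 by lra. ring. }
  rewrite E1, <- E2.
  replace (4 * p * Rpower 2 p * (M * M) * (Rpower x (- (p + 1)) * x))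
    with (2 * p * (Rpower 2 p * 2 * Rpower x (- (p + 1))) * (M * M * x)) by ring.
  apply Rmult_le_compat_l; [|exact Htt].
  pose proof (Rpower_pos 2 p). pose proof (Rpower_pos x (- (p + 1))).
  repeat apply Rmult_le_pos; lra.
Qed.

(** Estimating the two sums separately would leave an error of the order of the standard deviation
    when [p = alpha]. In the difference, the integrals recombine into increments symmetric about [A]
    and about [B], so only second-order errors survive, a factor [A^(-1/2)] smaller. *)
Lemma sumR_powList_diff_approx (p M A B L G : R) (i j c d : nat) :
  1 < p -> 0 < M -> 1 <= A <= B ->
  Rabs L <= M * sqrt A -> Rabs G <= M * sqrt B -> M * sqrt A <= A / 2 -> M * sqrt B <= B / 2 ->
  INR i = A + L -> INR j = A - L -> INR c = B + G -> INR d = B - G ->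
  (1 <= i <= c)%nat -> (1 <= j <= d)%nat ->
  Rabs (sumR (powList p i (S c - i)) - sumR (powList p j (S d - j))
        - 2 * (G * Rpower B (- p) - L * Rpower A (- p)))
  <= (1 + 8 * p * (M * M)) * Rpower 2 p * Rpower A (- p).
Proof.
  intros Hp HM HAB HL HG HA2 HB2 Hi Hj Hc Hd Hic Hjd.
  assert (HS := sumR_powList p i (c - i) Hp ltac:(lia)).
  replace (S (c - i)) with (S c - i)%nat in HS by lia.
  replace (i + (c - i))%nat with c in HS by lia.
  assert (HT := sumR_powList p j (d - j) Hp ltac:(lia)).
  replace (S (d - j)) with (S d - j)%nat in HT by lia.
  replace (j + (d - j))%nat with d in HT by lia.
  assert (HL2 := proj1 (Rabs_le_between L (A / 2)) ltac:(lra)).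
  assert (H1 := powPrim_symmetric_diff_sqrt p M A L Hp HM ltac:(lra) HL HA2).
  assert (H2 := powPrim_symmetric_diff_sqrt p M B G Hp HM ltac:(lra) HG HB2).
  rewrite <- Hi, <- Hj in H1. rewrite <- Hc, <- Hd in H2.
  assert (P2 := Rpower_pos 2 p).
  assert (Ki : Rpower (INR i) (- p) <= Rpower 2 p * Rpower A (- p)).
  { rewrite <- Rpower_half_neg by lra. apply Rpower_neg_le; lra. }
  assert (Kj : Rpower (INR j) (- p) <= Rpower 2 p * Rpower A (- p)).
  { rewrite <- Rpower_half_neg by lra. apply Rpower_neg_le; lra. }
  assert (HAB2 : Rpower B (- p) <= Rpower A (- p)) by (apply Rpower_neg_le; lra).
  assert (H3 : 4 * p * Rpower 2 p * (M * M) * Rpower B (- p)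
               <= 4 * p * Rpower 2 p * (M * M) * Rpower A (- p)).
  { apply Rmult_le_compat_l; [|exact HAB2]. repeat apply Rmult_le_pos; lra. }
  replace ((1 + 8 * p * (M * M)) * Rpower 2 p * Rpower A (- p)) with
    (Rpower 2 p * Rpower A (- p) + 4 * p * Rpower 2 p * (M * M) * Rpower A (- p)
     + 4 * p * Rpower 2 p * (M * M) * Rpower A (- p)) by ring.
  apply Rabs_le_between in H1. apply Rabs_le_between in H2.
  apply Rabs_le. lra.
Qed.

(** Used at both end coordinates, to replace the prefactor [x_c + x_d] by [2 B^(-alpha) / sg]. *)
Lemma Rpower_neg_ratio_approx (p M B G : R) :
  0 < p -> 0 < M -> 0 < B -> Rabs G <= M * sqrt B -> M * sqrt B <= B / 2 ->
  Rabs (Rpower (B + G) (- p) - Rpower B (- p))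
  <= 2 * p * M * Rpower 2 p * / sqrt B * Rpower B (- p).
Proof.
  intros Hp HM HB HG HB2.
  assert (HG2 := proj1 (Rabs_le_between G (B / 2)) ltac:(lra)).
  eapply Rle_trans; [apply (Rpower_neg_lip p (B / 2)); lra|].
  replace (B + G - B) with G by ring.
  rewrite Rpower_half_neg by lra.
  assert (E1 : Rpower 2 (p + 1) = Rpower 2 p * 2) by (rewrite Rpower_plus, Rpower_1; lra).
  assert (Hs : 0 < sqrt B) by (apply sqrt_lt_R0, HB).
  assert (E2 : Rpower B (- (p + 1)) * (sqrt B * sqrt B) = Rpower B (- p)).
  { rewrite sqrt_sqrt by lra. rewrite <- (Rpower_1 B HB) at 2. rewrite <- Rpower_plus. f_equal. ring. }
  rewrite E1, <- E2.
  replace (2 * p * M * Rpower 2 p * / sqrt B * (Rpower B (- (p + 1)) * (sqrt B * sqrt B)))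
    with (p * (Rpower 2 p * 2 * Rpower B (- (p + 1))) * (M * sqrt B)) by (field; lra).
  apply Rmult_le_compat_l; [|exact HG].
  pose proof (Rpower_pos 2 p). pose proof (Rpower_pos B (- (p + 1))).
  repeat apply Rmult_le_pos; lra.
Qed.

(** * Asymptotics for large [A] *)

(** The square is twice the integral of [u^(-2 alpha)] over [[A,B]]: the variance of the difference
    of the hitting times, with sums replaced by integrals and both coordinates started at [A] and
    ended at [B]. The factored form exposes the order [A^(1/2 - alpha)]. *)
Definition stdDev (alpha A B : R) : R :=
  sqrt (2 * (1 - Rpower (A / B) (2 * alpha - 1)) / (2 * alpha - 1)) * Rpower A (1 / 2 - alpha).

(** Leading term of the difference of the two mean hitting times, in units of the standard
    deviation. *)
Definition normMean (alpha A B L G : R) : R :=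
  2 * (G * Rpower B (- alpha) - L * Rpower A (- alpha)) / stdDev alpha A B.

(** The gap below 1 depends on [theta] and [alpha] only, so the variance cannot degenerate as [A]
    and [B] vary. *)
Lemma Rpower_ratio_bounds (alpha theta A B : R) :
  1 < alpha -> 1 < theta -> 0 < A -> theta * A <= B ->
  0 < Rpower (A / B) (2 * alpha - 1) <= Rpower (/ theta) (2 * alpha - 1) /\
  Rpower (/ theta) (2 * alpha - 1) < 1.
Proof.
  intros Ha Ht HA HB.
  assert (Hti : 0 < / theta) by (apply Rinv_0_lt_compat; lra).
  assert (HAB : A < B) by nra.
  split; [split; [apply Rpower_pos|]|].
  - apply Rle_Rpower_l; [lra|]. split; [apply Rdiv_lt_0_compat; lra|].
    apply (Rmult_le_reg_r (theta * B)); [nra|].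
    replace (A / B * (theta * B)) with (theta * A) by (field; lra).
    replace (/ theta * (theta * B)) with B by (field; lra). exact HB.
  -
    assert (H : / theta < 1) by (rewrite <- Rinv_1; apply Rinv_lt_contravar; lra).
    assert (Hln : ln (/ theta) < 0) by (rewrite <- ln_1; apply ln_increasing; lra).
    apply Rlt_le_trans with (exp 0); [apply exp_increasing; nra|rewrite exp_0; lra].
Qed.

Lemma stdDev_bounds (alpha theta A B : R) :
  1 < alpha -> 1 < theta -> 0 < A -> theta * A <= B ->
  sqrt (2 * (1 - Rpower (/ theta) (2 * alpha - 1)) / (2 * alpha - 1)) * Rpower A (1 / 2 - alpha)
  <= stdDev alpha A B
  <= sqrt (2 / (2 * alpha - 1)) * Rpower A (1 / 2 - alpha).
Proof.
  intros Ha Ht HA HB.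
  destruct (Rpower_ratio_bounds alpha theta A B) as [[H1 H2] H3]; try assumption.
  assert (Hi : 0 < / (2 * alpha - 1)) by (apply Rinv_0_lt_compat; lra).
  assert (Hh := Rpower_pos A (1 / 2 - alpha)).
  split; apply Rmult_le_compat_r; try lra; apply sqrt_le_1_alt; apply Rmult_le_compat_r; lra.
Qed.

Lemma stdDev_pos (alpha theta A B : R) :
  1 < alpha -> 1 < theta -> 0 < A -> theta * A <= B -> 0 < stdDev alpha A B.
Proof.
  intros Ha Ht HA HB.
  destruct (Rpower_ratio_bounds alpha theta A B) as [[H1 H2] H3]; try assumption.
  apply Rmult_lt_0_compat; [|apply Rpower_pos].
  apply sqrt_lt_R0, Rdiv_lt_0_compat; lra.
Qed.

Lemma stdDev_sqr (alpha theta A B : R) :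
  1 < alpha -> 1 < theta -> 0 < A -> theta * A <= B ->
  stdDev alpha A B * stdDev alpha A B = 2 * (powPrim (2 * alpha) B - powPrim (2 * alpha) A).
Proof.
  intros Ha Ht HA HB.
  destruct (Rpower_ratio_bounds alpha theta A B) as [[H1 H2] H3]; try assumption.
  assert (HAB : A < B) by nra.
  unfold stdDev.
  set (r := sqrt _). set (h := Rpower A (1 / 2 - alpha)).
  replace (r * h * (r * h)) with ((r * r) * (h * h)) by ring.
  unfold r. rewrite sqrt_sqrt by (left; apply Rdiv_lt_0_compat; lra).
  unfold h. rewrite <- Rpower_plus.
  replace (1 / 2 - alpha + (1 / 2 - alpha)) with (1 - 2 * alpha) by lra.
  unfold powPrim.
  assert (E : Rpower (A / B) (2 * alpha - 1) * Rpower A (1 - 2 * alpha) = Rpower B (1 - 2 * alpha)).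
  { unfold Rpower. rewrite <- exp_plus. f_equal. rewrite ln_div by lra. ring. }
  rewrite <- E. field. lra.
Qed.

(** The right side is the Fourier formula with its ingredients replaced by their limits:
    [(x_c + x_d) / (2 PI)] becomes [B^(-alpha) / (PI sg)], and the integral becomes its Gaussian
    value. *)
Lemma bingo_asymp_eq (alpha theta A B L G : R) :
  1 < alpha -> 1 < theta -> 0 < A -> theta * A <= B ->
  bingo_asymp alpha A B L G =
  Rpower B (- alpha) / (PI * stdDev alpha A B)
  * (sqrt (2 * PI) * exp (- (normMean alpha A B L G * normMean alpha A B L G) / 2)).
Proof.
  intros Ha Ht HA HB.
  destruct (Rpower_ratio_bounds alpha theta A B) as [[H1 H2] H3]; try assumption.
  assert (HAB : A < B) by nra.
  unfold bingo_asymp, normMean, stdDev.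
  set (Q := 1 - Rpower (A / B) (2 * alpha - 1)). assert (HQ : 0 < Q) by (unfold Q; lra).
  set (t := 2 * alpha - 1). assert (Htt : 0 < t) by (unfold t; lra).
  assert (Hpi := PI_RGT_0).
  set (h := Rpower A (1 / 2 - alpha)).
  assert (Hh : 0 < h) by apply Rpower_pos.
  replace (Rpower A (alpha - 1 / 2)) with (/ h)
    by (unfold h; rewrite <- Rpower_Ropp; f_equal; lra).
  replace (Rpower A (- alpha)) with (h / sqrt A).
  2:{ unfold h. rewrite <- (Rpower_neg_sqrt A alpha HA). field.
      apply Rgt_not_eq, sqrt_lt_R0, HA. }
  rewrite (Rpower_Ropp B alpha). set (b := Rpower B alpha).
  assert (Hb : 0 < b) by apply Rpower_pos.
  assert (HsA : 0 < sqrt A) by (apply sqrt_lt_R0, HA).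
  assert (E1 : 2 * Q / t = sqrt (2 * Q / t) * sqrt (2 * Q / t))
    by (symmetry; apply sqrt_sqrt; left; apply Rdiv_lt_0_compat; lra).
  assert (Hs : 0 < sqrt (2 * Q / t)) by (apply sqrt_lt_R0, Rdiv_lt_0_compat; lra).
  rewrite <- (Rmult_assoc _ (sqrt (2 * PI))). f_equal.
  - rewrite (sqrt_div_alt t PI), (sqrt_div_alt (2 * Q) t), !sqrt_mult by lra.
    assert (HsQ : 0 < sqrt Q) by (apply sqrt_lt_R0; lra).
    assert (Hst : 0 < sqrt t) by (apply sqrt_lt_R0; lra).
    assert (Hs2 : 0 < sqrt 2) by (apply sqrt_lt_R0; lra).
    assert (Hsp : 0 < sqrt PI) by (apply sqrt_lt_R0; lra).
    replace PI with (sqrt PI * sqrt PI) at 2 by (apply sqrt_sqrt; lra).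
    field. repeat split; lra.
  - f_equal. set (sq := sqrt (2 * Q / t)) in *.
    set (y := L / sqrt A - G / (b * h)).
    replace (2 * (G * / b - L * (h / sqrt A)) / (sq * h)) with (- 2 * y / sq)
      by (unfold y; field; repeat split; lra).
    replace (- 2 * y / sq * (- 2 * y / sq)) with (4 * y ^ 2 / (sq * sq)) by (field; lra).
    rewrite <- E1. field. split; lra.
Qed.

(** Both terms are at most [M A^(1/2 - alpha)] before normalisation, the one at [B] because [B >= A]
    and the exponent is negative. *)
Lemma normMean_bound (alpha theta M A B L G : R) :
  1 < alpha -> 1 < theta -> 0 < M -> 0 < A -> theta * A <= B ->
  Rabs L <= M * sqrt A -> Rabs G <= M * sqrt B ->
  Rabs (normMean alpha A B L G)
  <= 4 * M / sqrt (2 * (1 - Rpower (/ theta) (2 * alpha - 1)) / (2 * alpha - 1)).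
Proof.
  intros Ha Ht HM HA HB HL HG.
  destruct (Rpower_ratio_bounds alpha theta A B) as [[H1 H2] H3]; try assumption.
  assert (HAB : A < B) by nra.
  destruct (stdDev_bounds alpha theta A B) as [Hs _]; try assumption.
  assert (Hsp := stdDev_pos alpha theta A B Ha Ht HA HB).
  set (k := sqrt (2 * (1 - Rpower (/ theta) _) / _)) in *.
  assert (Hk : 0 < k) by (apply sqrt_lt_R0, Rdiv_lt_0_compat; lra).
  set (sg := stdDev alpha A B) in *. set (h := Rpower A (1 / 2 - alpha)) in *.
  assert (Hh : 0 < h) by apply Rpower_pos.
  assert (KB : Rabs (G * Rpower B (- alpha)) <= M * h).
  { rewrite Rabs_mult, (Rabs_right (Rpower B _)) by (left; apply Rpower_pos).
    apply Rle_trans with (M * sqrt B * Rpower B (- alpha)).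
    - apply Rmult_le_compat_r; [left; apply Rpower_pos|exact HG].
    - rewrite Rmult_assoc, (Rmult_comm (sqrt B)), Rpower_neg_sqrt by lra.
      apply Rmult_le_compat_l; [lra|]. unfold h.
      replace (1 / 2 - alpha) with (- (alpha - 1 / 2)) by ring. apply Rpower_neg_le; lra. }
  assert (KA : Rabs (L * Rpower A (- alpha)) <= M * h).
  { rewrite Rabs_mult, (Rabs_right (Rpower A _)) by (left; apply Rpower_pos).
    apply Rle_trans with (M * sqrt A * Rpower A (- alpha)).
    - apply Rmult_le_compat_r; [left; apply Rpower_pos|exact HL].
    - rewrite Rmult_assoc, (Rmult_comm (sqrt A)), Rpower_neg_sqrt by lra. apply Rle_refl. }
  unfold normMean. fold sg. unfold Rdiv at 1. rewrite Rabs_mult, (Rabs_right (/ sg))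
    by (left; apply Rinv_0_lt_compat, Hsp).
  apply (Rmult_le_reg_r sg); [exact Hsp|].
  rewrite Rmult_assoc, Rinv_l, Rmult_1_r by lra.
  apply Rle_trans with (4 * M * h).
  - apply Rabs_le_between in KA. apply Rabs_le_between in KB. apply Rabs_le; lra.
  - apply Rle_trans with (4 * M / k * (k * h)); [right; field; lra|].
    apply Rmult_le_compat_l; [|exact Hs]. apply Rmult_le_pos; [lra|left; apply Rinv_0_lt_compat, Hk].
Qed.

(** * Rescaled inverse rates of the chain *)

Definition invRate (alpha sg : R) (k : nat) : R := Rpower (INR k) (- alpha) / sg.

Definition invRates (alpha sg : R) (i c : nat) : list R := map (invRate alpha sg) (seq i (S c - i)).

Lemma invRate_pos (alpha sg : R) (k : nat) : 0 < sg -> 0 < invRate alpha sg k.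
Proof. intros. apply Rdiv_lt_0_compat; [apply Rpower_pos|assumption]. Qed.

Lemma sumR_invRates (alpha sg : R) (i c : nat) :
  sumR (invRates alpha sg i c) = sumR (powList alpha i (S c - i)) / sg.
Proof.
  unfold invRates, powList. induction (seq i (S c - i)) as [|k l IH]; simpl.
  - unfold Rdiv; ring.
  - rewrite IH. unfold invRate, Rdiv. ring.
Qed.

Lemma sumSq_invRates (alpha sg : R) (i c : nat) : 0 < sg ->
  sumSq (invRates alpha sg i c) = sumR (powList (2 * alpha) i (S c - i)) / (sg * sg).
Proof.
  intros Hs. unfold invRates, powList. induction (seq i (S c - i)) as [|k l IH]; simpl.
  - unfold Rdiv; ring.
  - rewrite IH. unfold invRate.
    replace (- (2 * alpha)) with (- alpha + - alpha) by ring. rewrite Rpower_plus. field. lra.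
Qed.

(** The free scale is used twice: [stdDev] for the asymptotics, and 1 for a bound valid at every
    [A]. *)
Lemma is_lim_charInt_bingo (alpha sg : R) (i j c d : nat) :
  1 < alpha -> 0 < sg -> (1 <= i <= c)%nat -> (1 <= j <= d)%nat ->
  is_lim (charInt (invRates alpha sg i c) (invRates alpha sg j d)) p_infty
    (2 * PI / (invRate alpha sg c + invRate alpha sg d) * bingo alpha i j c d).
Proof.
  intros Ha Hs Hi Hj.
  assert (Hw : forall k, (1 <= k)%nat -> wt alpha k = / (invRate alpha sg k * sg)).
  { intros k Hk. unfold invRate, Rdiv. rewrite Rmult_assoc, Rinv_l, Rmult_1_r by lra.
    rewrite Rpower_Ropp, Rinv_inv. destruct k; [lia|reflexivity]. }
  unfold bingo. rewrite (proj2 (Nat.leb_le i c)), (proj2 (Nat.leb_le j d)) by lia. simpl andb. cbv iota.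
  apply is_lim_charInt_reach; try lia.
  - intros k _. now apply invRate_pos.
  - intros k m Hk Hm E. unfold invRate in E.
    apply (Rmult_eq_reg_r (/ sg)) in E; [|apply Rinv_neq_0_compat; lra].
    rewrite !Rpower_Ropp in E. apply Rinv_eq_reg in E. unfold Rpower in E. apply exp_inv in E.
    apply Rmult_eq_reg_l in E; [|lra].
    apply INR_eq. apply ln_inv; try exact E; apply lt_0_INR; lia.
  - intros u v Hu Hv. unfold pright. rewrite !Hw by assumption.
    pose proof (invRate_pos alpha sg u Hs). pose proof (invRate_pos alpha sg v Hs).
    field. repeat split; lra.
  - intros u v Hu Hv. unfold pup. rewrite !Hw by assumption.
    pose proof (invRate_pos alpha sg u Hs). pose proof (invRate_pos alpha sg v Hs).
    field. repeat split; lra.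
Qed.

(** Natural coordinates tied to the real parameters by equations, so that the analysis never meets
    the integer halving of the final statement. *)
Definition admissible (M theta A B L G : R) (i j c d : nat) : Prop :=
  (0 < A /\ theta * A <= B /\ Rabs L <= M * sqrt A /\ Rabs G <= M * sqrt B) /\
  (INR i = A + L /\ INR j = A - L /\ INR c = B + G /\ INR d = B - G) /\
  (1 <= i /\ 1 <= j /\ 1 <= c /\ 1 <= d)%nat.

(** Here [h] is the order of magnitude of the divisor and [eta] the small relative error [A^(-1/2)].
    The lemma is applied with [(k, h)] for division by [sg] and with the squares for division by
    [sg * sg]. *)
Lemma Rdiv_le_of_scaled (u sg k h C eta : R) :
  0 < k -> 0 < h -> k * h <= sg -> 0 <= C * eta -> Rabs u <= C * (h * eta) ->
  Rabs (u / sg) <= C / k * eta.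
Proof.
  intros Hk Hh Hs HC Hu.
  assert (0 < k * h) by nra.
  unfold Rdiv at 1. rewrite Rabs_mult, (Rabs_right (/ sg)) by (left; apply Rinv_0_lt_compat; lra).
  apply (Rmult_le_reg_r sg); [lra|]. rewrite Rmult_assoc, Rinv_l, Rmult_1_r by lra.
  eapply Rle_trans; [exact Hu|].
  apply Rle_trans with (C / k * eta * (k * h)); [right; field; lra|].
  apply Rmult_le_compat_l; [|exact Hs].
  replace (C / k * eta) with (C * eta * / k) by (unfold Rdiv; ring).
  apply Rmult_le_pos; [exact HC|left; apply Rinv_0_lt_compat, Hk].
Qed.

(** The absolute error in the integral [J] becomes relative here, through the lower bound [N0] of
    its limit [N]. The factor [r] corrects the prefactor [P]; splitting [r J - N] as
    [r (J - N) + (r - 1) N] with [r <= 2] spends half of [e] on each term. *)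
Lemma bingo_error_factored (P r J N N0 e bg : R) :
  0 < P -> 0 < N0 <= N -> 0 < e -> bg = P * (r * J) -> Rabs (r - 1) <= 1 -> Rabs (r - 1) <= e / 2 ->
  Rabs (J - N) <= e * N0 / 4 -> Rabs (bg - P * N) <= e * (P * N).
Proof.
  intros HP HN He -> Hr1 Hr2 HJ.
  replace (P * (r * J) - P * N) with (P * (r * (J - N) + (r - 1) * N)) by ring.
  rewrite Rabs_mult, (Rabs_right P) by lra.
  replace (e * (P * N)) with (P * (e * N)) by ring.
  apply Rmult_le_compat_l; [lra|].
  eapply Rle_trans; [apply Rabs_triang|]. rewrite !Rabs_mult, (Rabs_right N) by lra.
  apply Rabs_le_between in Hr1.
  assert (Rabs r <= 2) by (apply Rabs_le; lra).
  pose proof (Rabs_pos r). pose proof (Rabs_pos (J - N)).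
  assert (Rabs r * Rabs (J - N) <= 2 * (e * N0 / 4)) by (apply Rmult_le_compat; lra).
  assert (Rabs (r - 1) * N <= e / 2 * N) by (apply Rmult_le_compat_r; lra).
  nra.
Qed.

Lemma bingo_asymp_large (alpha M theta e : R) :
  1 < alpha -> 0 < M -> 1 < theta -> 0 < e ->
  exists A0, forall A B L G i j c d, A0 <= A -> admissible M theta A B L G i j c d ->
    Rabs (bingo alpha i j c d - bingo_asymp alpha A B L G) <= e * bingo_asymp alpha A B L G.
Proof.
  intros Ha HM Ht He.
  assert (Hq0 : 0 < 1 - Rpower (/ theta) (2 * alpha - 1)).
  { destruct (Rpower_ratio_bounds alpha theta 1 theta) as [_ H]; lra. }
  set (k := sqrt (2 * (1 - Rpower (/ theta) (2 * alpha - 1)) / (2 * alpha - 1))).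
  assert (Hk : 0 < k) by (apply sqrt_lt_R0, Rdiv_lt_0_compat; lra).
  set (Kmu := 4 * M / k). assert (HKmu : 0 < Kmu) by (apply Rdiv_lt_0_compat; lra).
  assert (Hpi := PI_RGT_0).
  assert (Hs2pi : 0 < sqrt (2 * PI)) by (apply sqrt_lt_R0; lra).
  set (N0 := sqrt (2 * PI) * exp (- (Kmu * Kmu) / 2)).
  assert (HN0 : 0 < N0) by (apply Rmult_lt_0_compat; [exact Hs2pi|apply exp_pos]).
  destruct (local_limit Kmu (e * N0 / 4)) as [dl0 [Hdl0 Hlim]]; [exact HKmu|nra|].
  assert (P2 := Rpower_pos 2 alpha). assert (P22 := Rpower_pos 2 (2 * alpha)).
  (* Coefficients of [A^(-1/2)] in the four errors: sums of squares, centring, largest entry, end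
     rates. Their sum [K] bounds all of them. *)
  set (K1 := (2 * M + 1) * Rpower 2 (2 * alpha) / (k * k)).
  set (K2 := (1 + 8 * alpha * (M * M)) * Rpower 2 alpha / k).
  set (K3 := Rpower 2 alpha / k).
  set (K4 := 2 * alpha * M * Rpower 2 alpha).
  assert (HMM : 0 < M * M) by nra.
  assert (HK1 : 0 < K1) by (apply Rdiv_lt_0_compat; nra).
  assert (HK2 : 0 < K2).
  { apply Rdiv_lt_0_compat; [|exact Hk]. apply Rmult_lt_0_compat; [|exact P2]. nra. }
  assert (HK3 : 0 < K3) by (apply Rdiv_lt_0_compat; lra).
  assert (HK4 : 0 < K4) by (unfold K4; repeat apply Rmult_lt_0_compat; lra).
  set (K := K1 + K2 + K3 + K4). assert (HK : 0 < K) by (unfold K; lra).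
  set (tt := 1 - / theta).
  assert (Htt : 0 < tt).
  { unfold tt. assert (/ theta < 1) by (rewrite <- Rinv_1; apply Rinv_lt_contravar; lra). lra. }
  assert (T1 : 0 < 2 * M / tt) by (apply Rdiv_lt_0_compat; lra).
  assert (T2 : 0 < K / dl0) by (apply Rdiv_lt_0_compat; lra).
  assert (T3 : 0 < K / (e / 2)) by (apply Rdiv_lt_0_compat; lra).
  (* Each summand meets one demand on [sqrt A]: [A >= 1], shifts of at most half of [A] and [B], the
     end corner beyond the start corner, and [K / sqrt A] below [dl0], [e / 2] and 1. *)
  set (R0 := 1 + 2 * M + 2 * M / tt + K / dl0 + K / (e / 2) + K).
  exists (R0 * R0).
  intros A B L G i j c d HA0 [[HA [HB [HL HG]]] [[Hi [Hj [Hc Hd]]] [Hi1 [Hj1 [Hc1 Hd1]]]]].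
  assert (HR0 : 1 <= R0) by (unfold R0; lra).
  assert (HsA : R0 <= sqrt A).
  { rewrite <- (sqrt_square R0) by lra. apply sqrt_le_1_alt, HA0. }
  assert (HA1 : 1 <= A) by nra.
  assert (HAB : A < B) by nra.
  assert (HsAB : sqrt A <= sqrt B) by (apply sqrt_le_1_alt; lra).
  assert (EA : sqrt A * sqrt A = A) by (apply sqrt_sqrt; lra).
  assert (EB : sqrt B * sqrt B = B) by (apply sqrt_sqrt; lra).
  assert (H2M : 2 * M <= sqrt A) by (unfold R0 in HsA; lra).
  assert (HMA : M * sqrt A <= A / 2) by nra.
  assert (HMB : M * sqrt B <= B / 2) by nra.
  assert (HL' := proj1 (Rabs_le_between _ _) HL). assert (HG' := proj1 (Rabs_le_between _ _) HG).
  (* [B - A >= tt * B >= 2 M sqrt B], which exceeds both shifts; hence [i <= c] and [j <= d]. *)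
  assert (Hgap : A + M * sqrt A + M * sqrt B <= B).
  { assert (H1 : 2 * M <= tt * sqrt B).
    { apply Rle_trans with (tt * (2 * M / tt)); [right; field; lra|].
      apply Rmult_le_compat_l; [lra|]. unfold R0 in HsA; lra. }
    assert (H2 : A <= / theta * B).
    { apply (Rmult_le_reg_l theta); [lra|]. rewrite <- Rmult_assoc, Rinv_r, Rmult_1_l by lra. exact HB. }
    assert (H3 : B - / theta * B = tt * sqrt B * sqrt B) by (rewrite Rmult_assoc, EB; unfold tt; ring).
    nra. }
  assert (Hic : (i <= c)%nat) by (apply INR_le; lra).
  assert (Hjd : (j <= d)%nat) by (apply INR_le; lra).
  set (sg := stdDev alpha A B). set (mu := normMean alpha A B L G).
  assert (Hsg : 0 < sg) by (apply (stdDev_pos alpha theta); assumption).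
  destruct (stdDev_bounds alpha theta A B) as [Hsgk _]; try assumption.
  fold k in Hsgk. fold sg in Hsgk.
  assert (Hsg2 : sg * sg = 2 * (powPrim (2 * alpha) B - powPrim (2 * alpha) A))
    by (apply (stdDev_sqr alpha theta); assumption).
  set (h := Rpower A (1 / 2 - alpha)) in *. assert (Hh : 0 < h) by apply Rpower_pos.
  set (eta := / sqrt A).
  assert (Heta : 0 < eta) by (apply Rinv_0_lt_compat; lra).
  assert (Ehe : Rpower A (- alpha) = h * eta).
  { unfold h, eta. rewrite <- (Rpower_neg_sqrt A alpha HA). field. lra. }
  assert (Ehhe : Rpower A (1 / 2 - 2 * alpha) = h * h * eta).
  { rewrite Rmult_assoc, <- Ehe. unfold h. rewrite <- Rpower_plus. f_equal. ring. }
  set (dl := K * eta).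
  assert (Hdl : forall z, 0 < z -> K / z <= sqrt A -> dl <= z).
  { intros z Hz HKz. unfold dl, eta. apply (Rmult_le_reg_r (sqrt A)); [lra|].
    rewrite Rmult_assoc, Rinv_l, Rmult_1_r by lra.
    apply Rle_trans with (z * (K / z)); [right; field; lra|]. apply Rmult_le_compat_l; lra. }
  assert (Hd_dl0 : dl <= dl0) by (apply Hdl; [lra|unfold R0 in HsA; lra]).
  assert (Hd_e : dl <= e / 2) by (apply Hdl; [lra|unfold R0 in HsA; lra]).
  assert (Hd_1 : dl <= 1) by (apply Hdl; [lra|unfold R0 in HsA; unfold Rdiv; rewrite Rinv_1; lra]).
  assert (Hdlpos : 0 < dl) by (unfold dl; nra).
  assert (D1 : K1 * eta <= dl) by (unfold dl, K; nra).
  assert (D2 : K2 * eta <= dl) by (unfold dl, K; nra).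
  assert (D3 : K3 * eta <= dl) by (unfold dl, K; nra).
  assert (D4 : K4 * eta <= dl) by (unfold dl, K; nra).
  (* The shifts are left general so that [(L, G)] and [(- L, - G)] cover the two coordinates. *)
  assert (Hsq : forall u v L' G', INR u = A + L' -> INR v = B + G' -> (1 <= u <= v)%nat ->
            Rabs L' <= M * sqrt A -> Rabs G' <= M * sqrt B ->
            Rabs (sumSq (invRates alpha sg u v) - 1 / 2) <= dl).
  { intros u v L' G' Hu Hv Huv HL2 HG2.
    rewrite sumSq_invRates by exact Hsg.
    assert (H := sumR_powList_approx (2 * alpha) M A B L' G' u v ltac:(lra) HM ltac:(lra)
                   HL2 HG2 HMA HMB Hu Hv Huv).
    rewrite Ehhe in H.
    replace (sumR (powList (2 * alpha) u (S v - u)) / (sg * sg) - 1 / 2) with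
      ((sumR (powList (2 * alpha) u (S v - u)) - (powPrim (2 * alpha) B - powPrim (2 * alpha) A))
       / (sg * sg)) by (replace (powPrim (2 * alpha) B - powPrim (2 * alpha) A)
                          with (sg * sg / 2) by lra; field; lra).
    eapply Rle_trans; [|exact D1]. unfold K1.
    apply (Rdiv_le_of_scaled _ _ (k * k) (h * h)); try nra; try exact H.
    - replace (k * k * (h * h)) with (k * h * (k * h)) by ring. apply Rmult_le_compat; nra.
    - repeat apply Rmult_le_pos; lra. }
  assert (Hel : forall u v L', INR u = A + L' -> Rabs L' <= M * sqrt A ->
            forall x, In x (invRates alpha sg u v) -> 0 < x <= dl).
  { intros u v L' Hu HL2 x Hx. apply in_map_iff in Hx. destruct Hx as [n [<- Hn]].
    apply in_seq in Hn. split; [now apply invRate_pos|].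
    assert (HL3 := proj1 (Rabs_le_between L' (A / 2)) ltac:(lra)).
    assert (HnA : A / 2 <= INR n) by (apply Rle_trans with (INR u); [lra|apply le_INR; lia]).
    eapply Rle_trans; [apply Rle_abs|]. eapply Rle_trans; [|exact D3].
    unfold invRate, K3. apply (Rdiv_le_of_scaled _ _ k h); try assumption; [nra|].
    rewrite Rabs_right by (left; apply Rpower_pos).
    rewrite <- Ehe, <- Rpower_half_neg by lra. apply Rpower_neg_le; lra. }
  assert (HLn : Rabs (- L) <= M * sqrt A) by (rewrite Rabs_Ropp; exact HL).
  assert (HGn : Rabs (- G) <= M * sqrt B) by (rewrite Rabs_Ropp; exact HG).
  assert (Hmean : Rabs (sumR (invRates alpha sg i c) - sumR (invRates alpha sg j d) - mu) <= dl).
  { rewrite !sumR_invRates. unfold mu, normMean. fold sg.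
    assert (H := sumR_powList_diff_approx alpha M A B L G i j c d Ha HM ltac:(lra) HL HG HMA HMB
                   Hi Hj Hc Hd ltac:(lia) ltac:(lia)).
    set (X := sumR (powList _ i _)) in *. set (Y := sumR (powList _ j _)) in *.
    replace (X / sg - Y / sg - 2 * (G * Rpower B (- alpha) - L * Rpower A (- alpha)) / sg) with
      ((X - Y - 2 * (G * Rpower B (- alpha) - L * Rpower A (- alpha))) / sg) by (field; lra).
    eapply Rle_trans; [|exact D2]. unfold K2.
    apply (Rdiv_le_of_scaled _ _ k h); try assumption.
    - apply Rmult_le_pos; [|lra]. apply Rmult_le_pos; [nra|lra].
    - rewrite <- Ehe. exact H. }
  assert (Hmu : Rabs mu <= Kmu) by (apply (normMean_bound alpha theta M); assumption).
  assert (Hlimit := is_lim_charInt_bingo alpha sg i j c d Ha Hsg ltac:(lia) ltac:(lia)).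
  set (J := 2 * PI / (invRate alpha sg c + invRate alpha sg d) * bingo alpha i j c d) in *.
  assert (HJ : Rabs (J - sqrt (2 * PI) * exp (- (mu * mu) / 2)) <= e * N0 / 4).
  { apply (Hlim dl (invRates alpha sg i c) (invRates alpha sg j d) mu J); try assumption.
    - split; assumption.
    - apply (Hel i c L); assumption.
    - apply (Hel j d (- L)); [lra|assumption].
    - apply (Hsq i c L G); try assumption; lia.
    - apply (Hsq j d (- L) (- G)); try assumption; try lia; lra. }
  rewrite (bingo_asymp_eq alpha theta) by assumption. fold sg. fold mu.
  set (N := sqrt (2 * PI) * exp (- (mu * mu) / 2)) in *.
  set (b := Rpower B (- alpha)). assert (Hb : 0 < b) by apply Rpower_pos.
  (* Ratio of the exact prefactor to the one in the asymptotic formula. *)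
  set (r := (Rpower (INR c) (- alpha) + Rpower (INR d) (- alpha)) / (2 * b)).
  assert (Hr : Rabs (r - 1) <= dl).
  { assert (R1 := Rpower_neg_ratio_approx alpha M B G ltac:(lra) HM ltac:(lra) HG HMB).
    assert (R2 := Rpower_neg_ratio_approx alpha M B (- G) ltac:(lra) HM ltac:(lra) HGn HMB).
    replace (B + - G) with (B - G) in R2 by ring.
    rewrite <- Hc in R1. rewrite <- Hd in R2. fold K4 in R1, R2. fold b in R1, R2.
    assert (Hib : / sqrt B <= eta) by (unfold eta; apply Rinv_le_contravar; lra).
    assert (R3 : K4 * / sqrt B * b <= dl * b).
    { apply Rmult_le_compat_r; [lra|]. eapply Rle_trans; [|exact D4]. apply Rmult_le_compat_l; lra. }
    unfold r. set (u := Rpower (INR c) (- alpha)) in *. set (v := Rpower (INR d) (- alpha)) in *.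
    replace ((u + v) / (2 * b) - 1) with (((u - b) + (v - b)) / (2 * b)) by (field; lra).
    unfold Rdiv. rewrite Rabs_mult, (Rabs_right (/ (2 * b))) by (left; apply Rinv_0_lt_compat; lra).
    apply (Rmult_le_reg_r (2 * b)); [lra|]. rewrite Rmult_assoc, Rinv_l, Rmult_1_r by lra.
    apply Rabs_le_between in R1. apply Rabs_le_between in R2. apply Rabs_le; lra. }
  apply (bingo_error_factored _ r J N N0); try lra.
  - apply Rdiv_lt_0_compat; [exact Hb|nra].
  - split; [exact HN0|]. unfold N0, N. apply Rmult_le_compat_l; [lra|].
    assert (mu * mu <= Kmu * Kmu).
    { replace (mu * mu) with (Rabs mu * Rabs mu)
        by (rewrite <- Rabs_mult; apply Rabs_right, Rle_ge, Rle_0_sqr).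
      pose proof (Rabs_pos mu). apply Rmult_le_compat; lra. }
    apply exp_le_compat. lra.
  - unfold J, r, invRate.
    assert (Hc' := Rpower_pos (INR c) (- alpha)). assert (Hd' := Rpower_pos (INR d) (- alpha)).
    field. repeat split; lra.
Qed.

(** * Uniform error function *)

Lemma charInt_bound (xs ys : list R) (k T : R) :
  0 < k -> 0 <= T -> k * k <= sumSq xs -> k * k <= sumSq ys ->
  Rabs (charInt xs ys T) <= PI / k.
Proof.
  intros Hk HT Hx Hy.
  apply Rle_trans with (2 * atan (T * k) / k).
  - apply (norm_RInt_le (charRe xs ys) (fun s => / (1 + (s * k)²)) (- T) T); [lra| | |].
    + intros s _. eapply Rle_trans; [apply Rabs_charRe_le|].
      replace ((s * k)²) with (k * k * (s * s)) by (unfold Rsqr; ring).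
      apply rad_mul_le; nra.
    + apply (RInt_correct (V := R_CompleteNormedModule)), ex_RInt_charRe.
    + now apply RInt_inv_one_plus_sqr.
  - apply Rmult_le_compat_r; [left; apply Rinv_0_lt_compat, Hk|].
    pose proof (atan_bound (T * k)). lra.
Qed.

Lemma sumSq_invRates_ge (alpha sg : R) (i c : nat) : (i <= c)%nat ->
  invRate alpha sg i * invRate alpha sg i <= sumSq (invRates alpha sg i c).
Proof.
  intros H. unfold invRates. replace (S c - i)%nat with (S (c - i)) by lia. simpl.
  pose proof (sumSq_pos (map (invRate alpha sg) (seq (S i) (c - i)))). lra.
Qed.

Lemma bingo_nonneg (alpha : R) (i j c d : nat) : 0 <= bingo alpha i j c d.
Proof.
  assert (Hw : forall k, 0 <= wt alpha k)
    by (intros [|k]; simpl; [lra|left; apply Rpower_pos]).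
  assert (Hp : forall u v, 0 <= u -> 0 <= v -> 0 <= u / (u + v)).
  { intros u v Hu Hv. destruct (Req_dec (u + v) 0) as [E|E].
    - replace u with 0 by lra. unfold Rdiv. lra.
    - apply Rmult_le_pos; [exact Hu|]. left; apply Rinv_0_lt_compat; lra. }
  assert (Hr : forall n u v, 0 <= reach alpha c d n u v).
  { induction n as [|n IH]; intros u v; simpl; [destruct andb; lra|].
    apply Rplus_le_le_0_compat; apply Rmult_le_pos; try apply IH; unfold pright, pup.
    - now apply Hp.
    - rewrite Rplus_comm. now apply Hp. }
  unfold bingo. destruct andb; [apply Hr|lra].
Qed.

(** At scale 1 the first entry of each list alone is at least [m^(-alpha)], so the Fourier integral
    is at most [PI m^alpha]. The decay in [c] and [d] comes from the prefactor and matches that of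
    the asymptotic expression in [B]. *)
Lemma bingo_le (alpha : R) (i j c d : nat) (m : R) :
  1 < alpha -> (1 <= i)%nat -> (1 <= j)%nat -> INR i <= m -> INR j <= m ->
  bingo alpha i j c d
  <= (Rpower (INR c) (- alpha) + Rpower (INR d) (- alpha)) * Rpower m alpha / 2.
Proof.
  intros Ha Hi Hj Him Hjm.
  assert (Pc := Rpower_pos (INR c) (- alpha)). assert (Pd := Rpower_pos (INR d) (- alpha)).
  assert (Pm := Rpower_pos m alpha).
  destruct (andb (Nat.leb i c) (Nat.leb j d)) eqn:E.
  2:{ unfold bingo. rewrite E. nra. }
  apply andb_prop in E. destruct E as [Hic Hjd]. apply Nat.leb_le in Hic, Hjd.
  assert (Hlim := is_lim_charInt_bingo alpha 1 i j c d Ha Rlt_0_1 ltac:(lia) ltac:(lia)).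
  set (J := 2 * PI / _ * _) in Hlim.
  assert (Hi1 : 1 <= INR i) by (apply (le_INR 1), Hi).
  assert (Hj1 : 1 <= INR j) by (apply (le_INR 1), Hj).
  set (k := Rpower m (- alpha)). assert (Hk : 0 < k) by apply Rpower_pos.
  assert (Hki : k <= invRate alpha 1 i).
  { unfold invRate. rewrite Rdiv_1_r. apply Rpower_neg_le; lra. }
  assert (Hkj : k <= invRate alpha 1 j).
  { unfold invRate. rewrite Rdiv_1_r. apply Rpower_neg_le; lra. }
  assert (HJ : Rabs (J - 0) <= PI / k).
  { apply (is_lim_Rabs_le _ J 0 (PI / k) 0 Hlim). intros T HT. rewrite Rminus_0_r.
    apply charInt_bound; try lra.
    - eapply Rle_trans; [|apply sumSq_invRates_ge, Hic]. apply Rmult_le_compat; lra.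
    - eapply Rle_trans; [|apply sumSq_invRates_ge, Hjd]. apply Rmult_le_compat; lra. }
  rewrite Rminus_0_r in HJ. apply Rabs_le_between in HJ.
  assert (Hpi := PI_RGT_0).
  unfold J, invRate in HJ. rewrite !Rdiv_1_r in HJ.
  set (u := Rpower (INR c) (- alpha) + Rpower (INR d) (- alpha)) in *.
  assert (Hu : 0 < u) by (unfold u; lra).
  replace (Rpower m alpha) with (/ k) by (unfold k; now rewrite Rpower_Ropp, Rinv_inv).
  replace (bingo alpha i j c d) with (u / (2 * PI) * (2 * PI / u * bingo alpha i j c d))
    by (field; lra).
  apply Rle_trans with (u / (2 * PI) * (PI / k)).
  - apply Rmult_le_compat_l; [left; apply Rdiv_lt_0_compat|]; lra.
  - right; field; lra.
Qed.

Lemma bingo_asymp_pos (alpha theta A B L G : R) :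
  1 < alpha -> 1 < theta -> 0 < A -> theta * A <= B -> 0 < bingo_asymp alpha A B L G.
Proof.
  intros Ha Ht HA HB. rewrite (bingo_asymp_eq alpha theta) by assumption.
  assert (Hpi := PI_RGT_0). assert (Hsg := stdDev_pos alpha theta A B Ha Ht HA HB).
  apply Rmult_lt_0_compat.
  - apply Rdiv_lt_0_compat; [apply Rpower_pos|nra].
  - apply Rmult_lt_0_compat; [apply sqrt_lt_R0; lra|apply exp_pos].
Qed.

(** If [B >= 4 M^2] the shift is at most [B / 2]; otherwise [c >= 1] already exceeds
    [B / (4 M^2)]. *)
Lemma end_coord_ge (M B G : R) (c : nat) :
  0 < M -> 0 < B -> Rabs G <= M * sqrt B -> INR c = B + G -> (1 <= c)%nat ->
  Rmin (1 / 2) (/ (4 * (M * M))) * B <= INR c.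
Proof.
  intros HM HB HG Hc Hc1.
  assert (HMM : 0 < 4 * (M * M)) by nra.
  assert (H1 : 1 <= INR c) by (apply (le_INR 1), Hc1).
  destruct (Rle_dec (4 * (M * M)) B) as [Hle|Hgt].
  - apply Rle_trans with (1 / 2 * B); [apply Rmult_le_compat_r; [lra|apply Rmin_l]|].
    assert (Hs : 2 * M <= sqrt B).
    { rewrite <- (sqrt_square (2 * M)) by lra. apply sqrt_le_1_alt. lra. }
    assert (sqrt B * sqrt B = B) by (apply sqrt_sqrt; lra).
    assert (M * sqrt B <= B / 2) by nra.
    apply Rabs_le_between in HG. lra.
  - apply Rle_trans with (/ (4 * (M * M)) * B); [apply Rmult_le_compat_r; [lra|apply Rmin_r]|].
    apply Rle_trans with 1; [|exact H1].
    apply (Rmult_le_reg_l (4 * (M * M))); [lra|].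
    rewrite <- Rmult_assoc, Rinv_r by lra. lra.
Qed.

(** For fixed [A] the probability and the asymptotic expression are both controlled by [B^(-alpha)],
    the first from above and the second from below, so [C] does not depend on [B], [L] or [G]. *)
Lemma bingo_asymp_crude (alpha M theta A : R) :
  1 < alpha -> 0 < M -> 1 < theta ->
  exists C, forall B L G i j c d, admissible M theta A B L G i j c d ->
    Rabs (bingo alpha i j c d - bingo_asymp alpha A B L G) <= C * bingo_asymp alpha A B L G.
Proof.
  intros Ha HM Ht.
  assert (Hq0 : 0 < 1 - Rpower (/ theta) (2 * alpha - 1)).
  { destruct (Rpower_ratio_bounds alpha theta 1 theta) as [_ H]; lra. }
  set (Kmu := 4 * M / sqrt (2 * (1 - Rpower (/ theta) (2 * alpha - 1)) / (2 * alpha - 1))).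
  assert (Hpi := PI_RGT_0).
  assert (Hs2pi : 0 < sqrt (2 * PI)) by (apply sqrt_lt_R0; lra).
  set (N0 := sqrt (2 * PI) * exp (- (Kmu * Kmu) / 2)).
  assert (HN0 : 0 < N0) by (apply Rmult_lt_0_compat; [exact Hs2pi|apply exp_pos]).
  set (kap := Rmin (1 / 2) (/ (4 * (M * M)))).
  assert (Hkap : 0 < kap).
  { apply Rmin_pos; [lra|]. apply Rinv_0_lt_compat. nra. }
  set (sg1 := sqrt (2 / (2 * alpha - 1)) * Rpower A (1 / 2 - alpha)).
  set (C0 := Rpower kap (- alpha) * Rpower (2 * A) alpha).
  assert (HC0 : 0 < C0) by (apply Rmult_lt_0_compat; apply Rpower_pos).
  (* The 1 pays for the asymptotic expression itself, the other term for the probability. *)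
  exists (1 + C0 * (PI * sg1) / N0).
  intros B L G i j c d [[HA [HB [HL HG]]] [[Hi [Hj [Hc Hd]]] [Hi1 [Hj1 [Hc1 Hd1]]]]].
  assert (HAB : A < B) by nra.
  assert (HGn : Rabs (- G) <= M * sqrt B) by (rewrite Rabs_Ropp; exact HG).
  assert (Hcge := end_coord_ge M B G c HM ltac:(lra) HG Hc Hc1).
  assert (Hdge := end_coord_ge M B (- G) d HM ltac:(lra) HGn ltac:(lra) Hd1).
  fold kap in Hcge, Hdge.
  assert (Hi' : 1 <= INR i) by (apply (le_INR 1), Hi1).
  assert (Hj' : 1 <= INR j) by (apply (le_INR 1), Hj1).
  (* [2 A] bounds both start coordinates because they sum to it and are positive, without any
     smallness of [L]. *)
  assert (Hle := bingo_le alpha i j c d (2 * A) Ha Hi1 Hj1 ltac:(lra) ltac:(lra)).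
  assert (Hge := bingo_nonneg alpha i j c d).
  assert (Has := bingo_asymp_pos alpha theta A B L G Ha Ht HA HB).
  set (b := Rpower B (- alpha)). assert (Hb : 0 < b) by apply Rpower_pos.
  assert (HkB : 0 < kap * B) by nra.
  assert (Ekb : Rpower (kap * B) (- alpha) = Rpower kap (- alpha) * b)
    by (unfold b; symmetry; apply Rpower_mult_distr; lra).
  assert (Hc2 : Rpower (INR c) (- alpha) <= Rpower kap (- alpha) * b)
    by (rewrite <- Ekb; apply Rpower_neg_le; lra).
  assert (Hd2 : Rpower (INR d) (- alpha) <= Rpower kap (- alpha) * b)
    by (rewrite <- Ekb; apply Rpower_neg_le; lra).
  assert (Hbing : bingo alpha i j c d <= C0 * b).
  { eapply Rle_trans; [exact Hle|]. unfold C0.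
    pose proof (Rpower_pos (2 * A) alpha) as H2A.
    apply Rle_trans with (2 * (Rpower kap (- alpha) * b) * Rpower (2 * A) alpha / 2); [|right; field].
    apply Rmult_le_compat_r; [lra|]. apply Rmult_le_compat_r; lra. }
  assert (Hasl : b * N0 / (PI * sg1) <= bingo_asymp alpha A B L G /\ 0 < sg1).
  { rewrite (bingo_asymp_eq alpha theta) by assumption. fold b.
    assert (Hsg := stdDev_pos alpha theta A B Ha Ht HA HB).
    destruct (stdDev_bounds alpha theta A B) as [_ Hsgu]; try assumption.
    fold sg1 in Hsgu. split; [|lra].
    set (mu := normMean alpha A B L G).
    assert (Hmu : Rabs mu <= Kmu) by (apply (normMean_bound alpha theta M); assumption).
    replace (b * N0 / (PI * sg1)) with (b / (PI * sg1) * N0) by (field; lra).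
    apply Rmult_le_compat.
    - left; apply Rdiv_lt_0_compat; [lra|]. apply Rmult_lt_0_compat; lra.
    - lra.
    - apply Rmult_le_compat_l; [lra|]. apply Rinv_le_contravar.
      + apply Rmult_lt_0_compat; lra.
      + apply Rmult_le_compat_l; lra.
    - apply Rmult_le_compat_l; [lra|]. apply exp_le_compat.
      assert (mu * mu <= Kmu * Kmu); [|lra].
      replace (mu * mu) with (Rabs mu * Rabs mu)
        by (rewrite <- Rabs_mult; apply Rabs_right, Rle_ge, Rle_0_sqr).
      pose proof (Rabs_pos mu). apply Rmult_le_compat; lra. }
  destruct Hasl as [Hasl Hsg1].
  assert (Hfin : C0 * b <= C0 * (PI * sg1) / N0 * bingo_asymp alpha A B L G).
  { apply Rle_trans with (C0 * (PI * sg1) / N0 * (b * N0 / (PI * sg1))).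
    - right; field; lra.
    - apply Rmult_le_compat_l; [|exact Hasl]. left; apply Rdiv_lt_0_compat; [|lra].
      apply Rmult_lt_0_compat; [exact HC0|apply Rmult_lt_0_compat; lra]. }
  apply Rabs_le; lra.
Qed.

(* Their supremum serves as [eps A]; for small [A] it is finite by [bingo_asymp_crude]. *)
Definition relErrors (alpha M theta A : R) (r : R) : Prop :=
  exists B L G i j c d, admissible M theta A B L G i j c d /\
    r = Rabs (bingo alpha i j c d - bingo_asymp alpha A B L G) / bingo_asymp alpha A B L G.

Lemma Rabs_Lub_Rbar_le (E : R -> Prop) (e : R) :
  0 <= e -> (forall r, E r -> 0 <= r <= e) -> Rabs (real (Lub_Rbar E)) <= e.
Proof.
  intros He HE. destruct (Lub_Rbar_correct E) as [Hub Hlub].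
  assert (Hle : Rbar_le (Lub_Rbar E) (Finite e)) by (apply Hlub; intros r Hr; apply HE, Hr).
  (* [real] sends the infinities to 0, which settles an empty [E], whose supremum is [m_infty]. *)
  destruct (Lub_Rbar E) as [x| |]; simpl in *; try (rewrite Rabs_R0; exact He).
  apply Rabs_le. split; [|exact Hle].
  destruct (Rle_dec 0 x) as [|Hx]; [lra|].
  (* A negative finite supremum would force [E] to be empty, and then [m_infty] would be a smaller
     upper bound. *)
  exfalso. apply (Hlub m_infty).
  intros r Hr. specialize (Hub r Hr). specialize (HE r Hr). simpl in Hub. lra.
Qed.

(** The bound [C] rules out [p_infty], which [real] would collapse to 0. *)
Lemma le_Lub_Rbar (E : R -> Prop) (C r : R) :
  (forall r, E r -> r <= C) -> E r -> r <= real (Lub_Rbar E).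
Proof.
  intros HE Hr. destruct (Lub_Rbar_correct E) as [Hub Hlub].
  assert (Hle : Rbar_le (Lub_Rbar E) (Finite C)) by (apply Hlub; intros s Hs; apply HE, Hs).
  specialize (Hub r Hr).
  destruct (Lub_Rbar E); simpl in *; tauto.
Qed.

(** * Half-integer parameters and the final statement *)

Lemma INR_half_sum (a l : Z) : Z.Even (a + l) -> (Z.abs l < a)%Z ->
  INR (Z.to_nat ((a + l) / 2)) = IZR a / 2 + IZR l / 2 /\ (1 <= Z.to_nat ((a + l) / 2))%nat.
Proof.
  intros [m Hm] Hl. rewrite Hm, Z.mul_comm, Z.div_mul by lia.
  split; [|lia].
  rewrite INR_IZR_INZ, Z2Nat.id by lia.
  apply (f_equal IZR) in Hm. rewrite plus_IZR, mult_IZR in Hm. lra.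
Qed.

Lemma admissible_of_Z (M theta : R) (a b l g : Z) :
  Z.Even (a + l) -> Z.Even (b + g) -> 0 < IZR a / 2 -> theta * (IZR a / 2) <= IZR b / 2 ->
  Rabs (IZR l / 2) <= M * sqrt (IZR a / 2) -> Rabs (IZR g / 2) <= M * sqrt (IZR b / 2) ->
  (Z.abs l < a)%Z -> (Z.abs g < b)%Z ->
  admissible M theta (IZR a / 2) (IZR b / 2) (IZR l / 2) (IZR g / 2)
    (Z.to_nat ((a + l) / 2)) (Z.to_nat ((a - l) / 2))
    (Z.to_nat ((b + g) / 2)) (Z.to_nat ((b - g) / 2)).
Proof.
  intros Hal Hbg HA HB HL HG Hl Hg.
  assert (Hneg : forall u v, Z.Even (u + v) -> Z.Even (u + - v))
    by (intros u v [m Hm]; exists (m - v)%Z; lia).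
  destruct (INR_half_sum a l Hal Hl) as [E1 N1].
  destruct (INR_half_sum a (- l) (Hneg _ _ Hal) ltac:(lia)) as [E2 N2].
  destruct (INR_half_sum b g Hbg Hg) as [E3 N3].
  destruct (INR_half_sum b (- g) (Hneg _ _ Hbg) ltac:(lia)) as [E4 N4].
  rewrite opp_IZR in E2, E4.
  unfold admissible, Z.sub. repeat split; try assumption; lra.
Qed.

(* Half-integers A,B,Lam,Gam are encoded as a/2, b/2, l/2, g/2 with a,b,l,g : Z. *)
Theorem mainTheorem9 (alpha M theta : R) (Halpha : 1 < alpha) (HM : 0 < M) (Htheta : 1 < theta) :
  exists eps : R -> R,
    (forall e : R, 0 < e -> exists A0 : R, forall A : R, A0 <= A -> Rabs (eps A) <= e) /\
    forall a b l g : Z,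
      let A := IZR a / 2 in let B := IZR b / 2 in
      let Lam := IZR l / 2 in let Gam := IZR g / 2 in
      Z.Even (a + l) -> Z.Even (b + g) ->
      0 < A -> theta * A <= B ->
      Rabs Lam <= M * sqrt A -> Rabs Gam <= M * sqrt B ->
      (Z.abs l < a)%Z -> (Z.abs g < b)%Z ->
      Rabs (bingo alpha (Z.to_nat ((a + l) / 2)) (Z.to_nat ((a - l) / 2))
                        (Z.to_nat ((b + g) / 2)) (Z.to_nat ((b - g) / 2))
            - bingo_asymp alpha A B Lam Gam)
      <= eps A * bingo_asymp alpha A B Lam Gam.
Proof.
  (* Turns a bound on the difference into one on the ratio; it serves with [C = e] for large [A] and
     with the crude constant for arbitrary [A]. *)
  assert (Hratio : forall A C r, relErrors alpha M theta A r ->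
    (forall B L G i j c d, admissible M theta A B L G i j c d ->
      Rabs (bingo alpha i j c d - bingo_asymp alpha A B L G) <= C * bingo_asymp alpha A B L G) ->
    0 <= r <= C).
  { intros A C r [B [L [G [i [j [c [d [Hadm ->]]]]]]]] Hb.
    assert (Hpos : 0 < bingo_asymp alpha A B L G)
      by (destruct Hadm as [[HA [HB _]] _]; now apply (bingo_asymp_pos alpha theta)).
    specialize (Hb _ _ _ _ _ _ _ Hadm). split.
    - apply Rmult_le_pos; [apply Rabs_pos|left; apply Rinv_0_lt_compat, Hpos].
    - apply (Rmult_le_reg_r (bingo_asymp alpha A B L G)); [exact Hpos|].
      unfold Rdiv. rewrite Rmult_assoc, Rinv_l, Rmult_1_r by lra. exact Hb. }
  exists (fun A => real (Lub_Rbar (relErrors alpha M theta A))). split.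
  - intros e He.
    destruct (bingo_asymp_large alpha M theta e Halpha HM Htheta He) as [A0 HA0].
    exists A0. intros A HA. apply Rabs_Lub_Rbar_le; [lra|].
    intros r Hr. apply (Hratio A e r Hr). intros; now apply HA0.
  - intros a b l g A B Lam Gam Hal Hbg HA HB HL HG Hl Hg.
    assert (Hadm := admissible_of_Z M theta a b l g Hal Hbg HA HB HL HG Hl Hg).
    assert (Hpos : 0 < bingo_asymp alpha A B Lam Gam)
      by (now apply (bingo_asymp_pos alpha theta)).
    destruct (bingo_asymp_crude alpha M theta A Halpha HM Htheta) as [C HC].
    set (D := Rabs (_ - _)).
    replace D with (D / bingo_asymp alpha A B Lam Gam * bingo_asymp alpha A B Lam Gam)
      by (field; lra).
    apply Rmult_le_compat_r; [lra|].
    apply (le_Lub_Rbar _ C).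
    + intros r Hr. now apply (Hratio A C r Hr).
    + repeat eexists; try apply Hadm; reflexivity.
Qed.
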